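(* Let $1\leq i\leq k\leq d/2-1$. Let $\Delta$ be a $k$-stacked $(d-1)$-sphere that has no missing faces of dimension $\geq d-i+1$. Let $p$ be a $d$-embedding of $\Delta$ such that for every $d$-dimensional face $F$ of $T(\Delta)$, the $d+1$ points $p(F)$ are affinely independent. Then $$\mathrm{Stress}^a_1(\Delta,p)=\mathrm{Span}\{\partial_\mu\omega:\ \omega\in\mathrm{Stress}^a_i(\Delta,p),\ \mu\in\mathcal{M}_{i-1}(V(\Delta))\},$$ so $\mathrm{Stress}^a_i(\Delta,p)$ determines $\mathrm{Stress}^a_1(\Delta,p)$. In particular, if $P$ is a $k$-stacked simplicial $d$-polytope whose boundary complex has no missing faces of dimension $\geq d-i+1$, then the space of affine $i$-stresses of $P$ (with its natural embedding) determines $P$ up to affine equivalence.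
   Context: A $d$-dimensional complex $B$ is an $\mathbb{R}$-homology $d$-ball if it has the $\mathbb{R}$-homology of a $d$-ball, the link of every nonempty face $F$ has the $\mathbb{R}$-homology of a $(d-|F|)$-sphere or a $(d-|F|)$-ball, and the boundary complex $\partial B$ (faces whose links have the homology of balls) is an $\mathbb{R}$-homology $(d-1)$-sphere (for every face, including $\emptyset$, the link has the $\mathbb{R}$-homology of a sphere of dimension $d-2-|F|$... i.e. of the appropriate dimension). $B$ is $k$-stacked if every face of $B$ of dimension $\leq d-k-1$ lies in $\partial B$. A simplicial $(d-1)$-sphere $\Delta$ (complex whose geometric realization is homeomorphic to $S^{d-1}$) is $k$-stacked if $\Delta=\partial B$ for some $k$-stacked $\mathbb{R}$-homology $d$-ball $B$; a polytope is $k$-stacked if its boundary complex is. $T(\Delta)=\{F\subseteq V(\Delta):$ every subset of $F$ of size $\leq d-k$ is a face of $\Delta\}$. Missing face: vertex set not a face whose proper subsets are faces; dimension = size $-1$. A $d$-embedding is a map $p:V(\Delta)\to\mathbb{R}^d$. Affine stresses: in $\mathbb{R}[x_v]$ let $\theta_m=\sum_vp(v)_mx_v$ ($m=1,\dots,d$), $c=\sum_vx_v$, $\partial_\ell=\sum_v\ell_v\partial/\partial x_v$, $\partial_\mu=\partial_{x_{v_s}}\circ\cdots\circ\partial_{x_{v_1}}$ for $\mu=x_{v_1}\cdots x_{v_s}$; an affine $k$-stress on $(\Delta,p)$ is a homogeneous degree-$k$ polynomial whose monomials with nonzero coefficient are supported on faces of $\Delta$ and which is killed by $\partial_{\theta_1},\dots,\partial_{\theta_d},\partial_c$.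 $\mathcal{M}_r(W)$: squarefree degree-$r$ monomials in $x_w$, $w\in W$. $\mathrm{Stress}^a_1(\Delta,p)$ is the space of affine dependences of the $p(v)$. *)

(* Defs.v *)
From HB Require Import structures.
From mathcomp Require Import all_boot all_order all_algebra.
From mathcomp Require Import boolp classical_sets reals topology normedtype.
From mathcomp Require Import -(notations) mpoly.

Set Implicit Arguments.
Unset Strict Implicit.
Unset Printing Implicit Defensive.
Import Order.TTheory GRing.Theory Num.Theory.
Import numFieldNormedType.Exports.
Local Open Scope ring_scope.
Local Open Scope set_scope.
Local Open Scope classical_set_scope.

(* Vertices are labelled by elements of 'I_n, but not every label has to be a
   vertex; a complex is its set of faces, the empty face included. *)

Section Complexes.
Variable n : nat.
Implicit Types (D : {set {set 'I_n}}) (F G : {set 'I_n}).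

Definition is_complex D :=
  finset.set0 \in D /\ (forall F G, F \in D -> G \subset F -> G \in D).

Definition vertices D : {set 'I_n} := [set v : 'I_n | [set v]%SET \in D]%SET.

Definition fdim F : int := #|F|%:Z - 1.

Definition has_dim (e : int) D :=
  (forall F, F \in D -> fdim F <= e) /\ (exists2 F, F \in D & fdim F = e).

Definition link D F : {set {set 'I_n}} :=
  [set G : {set 'I_n} | [disjoint F & G] & F :|: G \in D]%SET.

Definition missing_face D F :=
  [/\ F \subset vertices D, F \notin D & forall G, G \proper F -> G \in D].

Definition Tcomplex (d k : nat) D : {set {set 'I_n}} :=
  [set F : {set 'I_n} | (F \subset vertices D) &&
     [forall G : {set 'I_n}, (G \subset F) && (#|G| <= d - k)%N ==> (G \in D)]]%SET.

End Complexes.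

Section Homology.
Variables (R : realType) (n : nat).
Implicit Types (D B : {set {set 'I_n}}) (F G : {set 'I_n}).

Local Notation chain := {ffun {set 'I_n} -> R^o}.

Definition face_chain F : chain := [ffun G => (G == F)%:R].

(* Chains are graded by cardinality: [chains D j] is spanned by the faces of
   dimension j - 1, so that j = 0 is the augmentation. *)
Definition chains D (j : nat) : {vspace chain} :=
  <<[seq face_chain F | F <- enum D & #|F| == j]>>%VS.

(* The coefficient of G in the boundary of c collects the faces v |: G, v being
   removed with the sign given by its position in the increasing enumeration. *)
Definition bd_fun (c : chain) : chain :=
  [ffun G : {set 'I_n} => \sum_(v : 'I_n | v \notin G)
     (-1) ^+ #|[set u in G | (u < v)%N]%SET| * c (v |: G)%SET].

Lemma bd_fun_is_linear : linear bd_fun.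
Proof.
move=> a x y; apply/ffunP=> G; rewrite !ffunE /= scaler_sumr -big_split /=.
apply: eq_bigr => v _; rewrite !ffunE mulrDr; congr (_ + _).
by rewrite /GRing.scale /= mulrCA.
Qed.

HB.instance Definition _ :=
  GRing.isLinear.Build R chain chain _ bd_fun bd_fun_is_linear.

Definition bd : 'End(chain) := linfun bd_fun.

(* Dimension of the reduced homology of D in degree j - 1. *)
Definition rbetti D (j : nat) : nat :=
  (\dim (chains D j :&: lker bd) - \dim (bd @: chains D j.+1))%N.

Definition has_sphere_homology (e : int) D :=
  forall j, rbetti D j = (j%:Z - 1 == e) :> nat.

Definition has_ball_homology D := forall j, rbetti D j = 0%N.

Definition homology_sphere (e : int) D :=
  [/\ is_complex D, has_dim e D
    & forall F, F \in D -> has_sphere_homology (e - #|F|%:Z) (link D F)].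

Definition boundary_complex B : {set {set 'I_n}} :=
  [set F in B | `[< has_ball_homology (link B F) >]]%SET.

Definition homology_ball (d : nat) B :=
  [/\ is_complex B, has_dim d%:Z B, has_ball_homology B,
      forall F, F \in B -> F != finset.set0 ->
        has_sphere_homology (d%:Z - #|F|%:Z) (link B F)
        \/ has_ball_homology (link B F)
    & homology_sphere (d%:Z - 1) (boundary_complex B)].

Definition stacked_ball (d k : nat) B :=
  forall F, F \in B -> fdim F <= d%:Z - k%:Z - 1 -> F \in boundary_complex B.

(* B may be taken on the labels of D: for k < d all its vertices lie in its
   boundary D. *)
Definition k_stacked (d k : nat) D :=
  exists B, [/\ homology_ball d B, stacked_ball d k B & boundary_complex B = D].

End Homology.

Section Topology.
Variable R : realType.

Definition homeomorphic (X Y : topologicalType) (A : set X) (B : set Y) :=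
  exists (f : X -> Y) (g : Y -> X),
    [/\ {within A, continuous f}, {within B, continuous g},
        (forall x, A x -> B (f x) /\ g (f x) = x)
      & (forall y, B y -> A (g y) /\ f (g y) = y)].

Definition realization n (D : {set {set 'I_n}}) : set 'rV[R]_n :=
  [set x | [/\ forall v, 0 <= x 0 v, \sum_v x 0 v = 1
             & [set v | x 0 v != 0]%SET \in D]].

Definition unit_sphere d : set 'rV[R]_d := [set x | \sum_j x 0 j ^+ 2 = 1].

Definition simplicial_sphere d n (D : {set {set 'I_n}}) :=
  is_complex D /\ homeomorphic (realization D) (@unit_sphere d).

End Topology.

Section Stresses.
Variables (R : realType) (n d : nat).
Implicit Types (D : {set {set 'I_n}}) (p : 'I_n -> 'rV[R]_d).

Local Notation poly_ring := (mpoly n R).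

Definition dlin D (l : 'I_n -> R) (w : poly_ring) : poly_ring :=
  \sum_(v in vertices D) l v *: mderiv v w.

Definition stress (r : nat) D p : set poly_ring :=
  [set w | [/\ w \is ishomog1 r mdeg,
               forall m, m \in msupp w -> [set v | m v != 0%N]%SET \in D,
               forall j, dlin D (fun v => p v 0 j) w = 0
             & dlin D (fun=> 1) w = 0]].

Definition sqfree_mon (r : nat) (W : {set 'I_n}) : set (multinom n) :=
  [set m | mdeg m = r /\ forall v, (m v <= (v \in W))%N].

Definition aff_indep p (F : {set 'I_n}) :=
  forall a : 'I_n -> R, \sum_(v in F) a v = 0 -> \sum_(v in F) a v *: p v = 0 ->
    forall v, v \in F -> a v = 0.

End Stresses.

Definition lspan (R : realType) (V : lmodType R) (A : set V) : set V :=
  [set x | exists (m : nat) (a : 'I_m -> R) (y : 'I_m -> V),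
     (forall j, A (y j)) /\ x = \sum_j a j *: y j].

Section Polytopes.
Variables (R : realType) (n d : nat).
Implicit Types (p q : 'I_n -> 'rV[R]_d).

Definition hull p : set 'rV[R]_d :=
  [set x | exists a : 'I_n -> R,
     [/\ forall v, 0 <= a v, \sum_v a v = 1 & x = \sum_v a v *: p v]].

Definition dotp (x y : 'rV[R]_d) : R := \sum_j x 0 j * y 0 j.

Definition face_of (P G : set 'rV[R]_d) :=
  exists (a : 'rV[R]_d) (b : R),
    (forall x, P x -> dotp a x <= b) /\ G = P `&` [set x | dotp a x = b].

Definition polytope_complex p : {set {set 'I_n}} :=
  [set F : {set 'I_n} | `[< exists G : set 'rV[R]_d,
     [/\ face_of (hull p) G, G <> hull p & forall v, v \in F <-> G (p v)] >]]%SET.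

(* p lists without repetition the vertices of the full-dimensional simplicial
   polytope [hull p]. *)
Definition simplicial_polytope p :=
  [/\ injective p, forall v, face_of (hull p) [set p v],
      exists2 F : {set 'I_n}, #|F| = d.+1 & aff_indep p F
    & forall F, F \in polytope_complex p -> aff_indep p F].

Definition affinely_equivalent p q :=
  exists (A : 'M[R]_d) (b : 'rV[R]_d),
    [/\ A \in unitmx, (fun x => x *m A + b) @` hull p = hull q
      & forall v, q v = p v *m A + b].

End Polytopes.

(* The hypotheses on (Delta, p), apart from 1 <= i <= k <= d/2 - 1. *)
Definition stacked_embedding (R : realType) (d i k n : nat)
    (D : {set {set 'I_n}}) (p : 'I_n -> 'rV[R]_d) :=
  [/\ simplicial_sphere R d D, k_stacked R d k D,
      forall F, missing_face D F -> fdim F < d%:Z - i%:Z + 1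
    & forall F, F \in Tcomplex d k D -> fdim F = d%:Z -> aff_indep p F].

(* Main.v *)
Require Import Defs.
From HB Require Import structures.
From mathcomp Require Import all_boot all_order all_algebra.
From mathcomp Require Import boolp classical_sets reals topology normedtype.
From mathcomp Require Import -(notations) mpoly.
From mathcomp Require Import zify ring.
Import Order.TTheory GRing.Theory Num.Theory.
Local Open Scope ring_scope.
Local Open Scope classical_set_scope.

Set Implicit Arguments.
Unset Strict Implicit.
Unset Printing Implicit Defensive.
Local Open Scope set_scope.

(* Let B be the stacked ball, D its boundary, and P v = (1, p v) in R^(d+1).

   Affine 1-stresses are spanned by those of adjacent facets: heights on the vertices
   that annihilate, for every interior ridge G of B, one dependence of the d + 2 points
   of the two facets through G are affine on each facet, and then affine globally, as
   the facets of B are strongly connected through interior ridges.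

   Each such dependence is a derivative of an i-stress.  Since D has no missing face on
   d - i + 2 or more vertices, G contains an interior face A with d - i + 1 vertices; its
   link is a homology (i-1)-sphere, with a top cycle z.  For a generic c in R^(d+1) with
   coordinates c_{S,v} in the bases P(A U S), the polynomial
       sum_S  z_S / (det P(A U S) prod_{v in S} c_{S,v})  (sum_v c_{S,v} x_v)^i
   (S over the facets of the link) is an i-stress: applying a linear form th to the
   points multiplies the sum with exponent i - 1 by i th(c), and that sum vanishes.
   Its derivative along G \ A is the dependence sought.  Supports have at most
   i <= d - k vertices, so these faces of B belong to D.

   For polytopes, a set of d + 1 points all of whose (d-k)-subsets are faces is affinely
   independent, since one of the two sign classes of a dependence would be a face. *)

(** * Reduced homology in low degrees *)

Section HomologyLowDegree.
Variables (R : realType) (n : nat).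
Implicit Types (E : {set {set 'I_n}}) (F G : {set 'I_n}).
Implicit Type c : {ffun {set 'I_n} -> R^o}.

(** Replaces membership in a span by a condition on supports: a function on sets is the combination
    of the face chains weighted by its own values. *)
Lemma mem_chains E j c :
  (c \in chains R E j) <-> (forall G, c G != 0 -> G \in E /\ #|G| = j).
Proof.
split=> [|cE].
  rewrite /chains; set X := map _ _ => /(@coord_span _ _ _ (in_tuple X)) -> G.
  rewrite sum_ffunE; apply: contra_neqP => GE; apply: big1 => t _; rewrite ffunE.
  have /mapP[F] : X`_t \in X by rewrite mem_nth // ltn_ord.
  rewrite mem_filter mem_enum => /andP[/eqP Fj FE] ->.
  rewrite ffunE; case: eqVneq => [GF|]; last by rewrite scaler0.
  by case: GE; rewrite GF.
have -> : c = \sum_(G | c G != 0) (c G : R) *: face_chain R G.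
  apply/ffunP => F; rewrite sum_ffunE; case: (eqVneq (c F) 0) => cF.
    rewrite cF big1 // => G cG; rewrite !ffunE.
    by case: eqVneq => [FG|]; rewrite ?scaler0 // -FG cF eqxx in cG *.
  rewrite (bigD1 F) //= big1 ?addr0 => [|G /andP[_ /negPf GF]].
    by rewrite !ffunE eqxx /GRing.scale /= mulr1.
  by rewrite !ffunE eq_sym GF scaler0.
apply: memv_suml => G cG; apply: memvZ; apply: memv_span.
by have [GE Gj] := cE G cG; rewrite map_f // mem_filter mem_enum Gj eqxx.
Qed.

Lemma bdE c G : bd R n c G =
  \sum_(v | v \notin G) (-1) ^+ #|[set u in G | (u < v)%N]%SET| * c (v |: G)%SET.
Proof. by rewrite lfunE /= ffunE. Qed.

Lemma chains_eq0 E j : (forall G, G \in E -> #|G| != j) -> chains R E j = 0%VS.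
Proof.
move=> noE; apply/eqP; rewrite -subv0; apply/subvP => c /mem_chains cE.
rewrite memv0; apply/eqP/ffunP => G; rewrite [RHS]ffunE; apply/eqP.
case: eqVneq => // cG; have [/noE + Gj] := cE _ cG.
by rewrite Gj eqxx.
Qed.

Lemma rbetti_eqcard_dim E j : (forall G, G \in E -> (#|G| <= j)%N) ->
  rbetti R E j = \dim (chains R E j :&: lker (bd R n)).
Proof.
move=> Ej; by rewrite /rbetti (@chains_eq0 _ j.+1) ?limg0 ?dimv0 ?subn0 // => G /Ej; lia.
Qed.


Lemma dim_gt1 (V : vectType R) (U : {vspace V}) (x y : V) :
  x \in U -> y \in U -> free [:: x; y] -> (1 < \dim U)%N.
Proof.
move=> xU yU; rewrite /free => /eqP; rewrite [size _]/= => <-; apply: dimvS; apply/span_subvP => z.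
by rewrite !inE => /orP[] /eqP ->.
Qed.

(** The complex whose only face is empty is the sphere of dimension -1. It is the link of a maximal
    face, which is how the size of facets is found later. *)
Lemma rbetti_irrelevant E : E = [set finset.set0]%SET -> rbetti R E 0 = 1%N.
Proof.
move=> E0; rewrite rbetti_eqcard_dim => [|G]; last first.
  by rewrite E0 inE => /eqP ->; rewrite cards0.
suff -> : (chains R E 0 :&: lker (bd R n) = <[face_chain R finset.set0]>)%VS.
  rewrite dim_vline; case: eqP => // /ffunP/(_ finset.set0)/eqP.
  by rewrite !ffunE eqxx oner_eq0.
have E0c : chains R E 0 = <[face_chain R finset.set0]>%VS.
  rewrite /chains E0 (_ : enum _ = [:: finset.set0]) ?enum_set1 //.
  by rewrite /= cards0 eqxx span_seq1.
rewrite E0c; apply/capv_idPl; rewrite -memvE memv_ker; apply/eqP/ffunP => G.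
rewrite bdE [RHS]ffunE big1 // => v vG; rewrite ffunE.
suff /negPf -> : (v |: G)%SET != finset.set0 by rewrite mulr0.
by apply/set0Pn; exists v; rewrite setU11.
Qed.

Lemma bd_chains1_eq0 E c : c \in chains R E 1 -> \sum_v c [set v]%SET = 0 ->
  bd R n c = 0.
Proof.
move=> /mem_chains cE c0; apply/ffunP => G; rewrite bdE [RHS]ffunE.
have [->|/set0Pn[u uG]] := eqVneq G finset.set0.
  rewrite -[RHS]c0; apply: eq_big => [v|v _]; first by rewrite inE.
  rewrite finset.setU0 (_ : [set _ in _ | _]%SET = finset.set0) ?cards0 ?mul1r //.
  by apply/setP => u; rewrite !inE.
rewrite big1 // => v vG; case: (eqVneq (c (v |: G)%SET) 0) => [->|/cE[_]].
  by rewrite mulr0.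
rewrite cardsU1 vG add1n => -[] /eqP; rewrite cards_eq0 => /eqP G0.
by rewrite G0 inE in uG.
Qed.

(** Closure of [S] along edges discards every edge that leaves [S]. What remains is a sum of an
    antisymmetric function over ordered pairs in [S], hence equal to its own negative. *)
Lemma sum_bd_edges E (S : {set 'I_n}) c :
    (forall u v, u \in S -> [set u; v]%SET \in E -> v \in S) ->
  c \in chains R E 2 -> \sum_(v in S) bd R n c [set v]%SET = 0.
Proof.
move=> Sc /mem_chains cE.
(* The signed contribution of the edge [uv] to its endpoint [v]. The diagonal must be 0 for [s] to
   be antisymmetric. *)
pose s (u v : 'I_n) : R := if (u == v) then 0 else (-1) ^+ (v < u)%N * c [set u; v]%SET.
have -> : \sum_(v in S) bd R n c [set v]%SET = \sum_(v in S) \sum_(u in S) s u v.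
  apply: eq_bigr => v vS; rewrite bdE big_mkcond [RHS]big_mkcond /=.
  apply: eq_bigr => u _; rewrite inE /s; case: eqVneq => uv /=; first by case: ifP.
  rewrite (_ : #|_| = (v < u)%N :> nat); last first.
    rewrite -sum1dep_card; under eq_bigl => w do rewrite !inE.
    rewrite big_mkcondr big_pred1_eq; by case: ltnP.
  case: ifPn => // uS; case: (eqVneq (c [set u; v]%SET) 0) => [->|/cE[uvE _]].
    by rewrite mulr0.
  by case/negP: uS; apply: (Sc v); rewrite // finset.setUC.
have sN u v : s u v = - s v u.
  rewrite /s; case: eqVneq => [_|uv]; first by rewrite oppr0.
  rewrite finset.setUC -mulNr; congr (_ * _).
  by move: uv; rewrite -(inj_eq val_inj) /=; case: ltngtP; rewrite ?expr0 ?expr1 ?opprK.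
apply/eqP; rewrite -[_ == 0]/(_ == 0); set A := \sum_(v in S) _.
have AN : A = - A.
  rewrite {1}/A exchange_big /= /A -sumrN; apply: eq_bigr => u _.
  by rewrite -sumrN; apply: eq_bigr => v _; rewrite sN.
have : A *+ 2 == 0 by rewrite mulr2n {2}AN subrr.
by rewrite mulrn_eq0.
Qed.

Lemma bd_bd_edges E c : c \in chains R E 2 -> bd R n (bd R n c) = 0.
Proof.
move=> cE; have c1 : bd R n c \in chains R [set: {set 'I_n}]%SET 1.
  apply/mem_chains => G; rewrite inE => cG; split=> //; move: cG.
  rewrite bdE; apply: contra_neqP => G1; apply: big1 => v vG.
  case: (eqVneq (c (v |: G)%SET) 0) => [->|]; first by rewrite mulr0.
  by move/mem_chains : cE => /[apply] -[_]; rewrite cardsU1 vG; lia.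
apply: bd_chains1_eq0 c1 _.
have := @sum_bd_edges E [set: 'I_n]%SET c (fun _ _ _ _ => finset.in_setT _) cE.
by under eq_bigl => v do rewrite inE.
Qed.

Definition diff_chain (a b : 'I_n) : {ffun {set 'I_n} -> R^o} :=
  face_chain R [set a]%SET - face_chain R [set b]%SET.

Lemma diff_chain_cycle E a b : [set a]%SET \in E -> [set b]%SET \in E ->
  diff_chain a b \in (chains R E 1 :&: lker (bd R n))%VS.
Proof.
move=> aE bE.
have cE : diff_chain a b \in chains R E 1.
  apply: memvB; apply: memv_span; rewrite map_f // mem_filter mem_enum cards1 eqxx //.
rewrite memv_cap cE memv_ker; apply/eqP; apply: bd_chains1_eq0 cE _.
have sum1 (v : 'I_n) : \sum_u face_chain R [set v]%SET [set u]%SET = 1.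
  rewrite (bigD1 v) //= ffunE eqxx big1 ?addr0 // => u uv; rewrite ffunE.
  by rewrite (inj_eq set1_inj) (negPf uv).
have dE v : diff_chain a b [set v]%SET =
    face_chain R [set a]%SET [set v]%SET - face_chain R [set b]%SET [set v]%SET.
  by rewrite /diff_chain ffunE [X in _ + X]ffunE.
under eq_bigr => v _ do rewrite dE.
by rewrite sumrB !sum1 subrr.
Qed.

(** The difference of two vertices is a cycle, hence the boundary of an edge chain. Summed over [S],
    a boundary gives 0, whereas the difference would give 1 if [S] contained [a] but not [b]. *)
Lemma rbetti1_connected E (S : {set 'I_n}) a b : is_complex E ->
    rbetti R E 1 = 0%N -> (forall u v, u \in S -> [set u; v]%SET \in E -> v \in S) ->
  [set a]%SET \in E -> [set b]%SET \in E -> a \in S -> b \in S.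
Proof.
move=> [_ subE] /eqP; rewrite subn_eq0 => rb Sc aE bE aS; apply/negPn/negP => bS.
(* As [rbetti] is a truncated difference, its vanishing only says that there are at least as many
   boundaries as cycles; this inclusion turns that into equality of the two spaces. *)
have imE : (bd R n @: chains R E 2 <= chains R E 1 :&: lker (bd R n))%VS.
  apply/subvP => _ /memv_imgP[c cE ->].
  rewrite memv_cap memv_ker (bd_bd_edges cE) eqxx andbT.
  apply/mem_chains => G; rewrite bdE => cG.
  have [v vG cv] : exists2 v, v \notin G & c (v |: G)%SET != 0.
    apply/exists_inP; apply: contra_neqT cG => /exists_inPn cG.
    by apply: big1 => v /cG; rewrite negbK => /eqP ->; rewrite mulr0.
  move/mem_chains : cE => /(_ _ cv)[GE]; rewrite cardsU1 vG => -[G1].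
  by split=> //; apply: subE GE _; exact: finset.subsetUr.
have := diff_chain_cycle aE bE; move: (dimv_leqif_sup imE).
move/geq_leqif; rewrite rb => /esym/subvP/[apply] /memv_imgP[c cE cab].
have := sum_bd_edges Sc cE; rewrite -cab.
under eq_bigr => v do rewrite /diff_chain 4!ffunE !(inj_eq set1_inj).
rewrite sumrB (bigD1 a) //= eqxx !big1 ?addr0 ?subr0 => [/eqP|v vS|v /andP[_ /negPf ->] //].
  by rewrite oner_eq0.
by case: eqVneq => // vb; rewrite -vb vS in bS.
Qed.

Lemma free_diff_chains a b b' : a != b -> a != b' -> b != b' ->
  free [:: diff_chain a b; diff_chain a b'].
Proof.
move=> ab ab' bb'; rewrite free_cons seq1_free span_seq1; apply/andP; split.
  apply/vlineP => -[k] /ffunP/(_ [set b]%SET)/eqP.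
  rewrite !ffunE !(inj_eq set1_inj) eqxx [b == a]eq_sym (negPf ab) (negPf bb').
  by rewrite subr0 scaler0 sub0r oppr_eq0 oner_eq0.
apply/eqP => /ffunP/(_ [set a]%SET)/eqP.
by rewrite !ffunE !(inj_eq set1_inj) eqxx (negPf ab') subr0 oner_eq0.
Qed.

Lemma rbetti1_points_neq0 E a b : (forall G, G \in E -> (#|G| <= 1)%N) ->
  [set a]%SET \in E -> [set b]%SET \in E -> a != b -> rbetti R E 1 <> 0%N.
Proof.
move=> E1 aE bE ab; rewrite (rbetti_eqcard_dim E1) => /eqP; rewrite dimv_eq0 => /eqP E0.
have := diff_chain_cycle aE bE; rewrite E0 memv0 => /eqP/ffunP/(_ [set a]%SET)/eqP.
by rewrite !ffunE !(inj_eq set1_inj) eqxx (negPf ab) subr0 oner_eq0.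
Qed.

(** Without edges no cycle is a boundary, and three points carry two independent difference
    cycles. *)
Lemma rbetti1_points_neq1 E a b b' : (forall G, G \in E -> (#|G| <= 1)%N) ->
  [set a]%SET \in E -> [set b]%SET \in E -> [set b']%SET \in E ->
  a != b -> a != b' -> b != b' -> rbetti R E 1 <> 1%N.
Proof.
move=> E1 aE bE bE' ab ab' bb'; rewrite (rbetti_eqcard_dim E1) => d1.
have := dim_gt1 (diff_chain_cycle aE bE) (diff_chain_cycle aE bE')
  (free_diff_chains ab ab' bb').
by rewrite d1.
Qed.

Lemma rbetti1_cycle E j : rbetti R E j = 1%N ->
  exists2 z, z \in chains R E j & bd R n z = 0 /\ z != 0.
Proof.
rewrite /rbetti => rb.
have : (chains R E j :&: lker (bd R n) != 0)%VS by rewrite -dimv_eq0; lia.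
rewrite -vpick0 => z0; have := memv_pick (chains R E j :&: lker (bd R n))%VS.
rewrite memv_cap memv_ker => /andP[zE /eqP z1].
by exists (vpick (chains R E j :&: lker (bd R n))%VS).
Qed.

End HomologyLowDegree.

(** * Combinatorics of homology balls *)

Section Ball.
Variables (R : realType) (n d : nat) (B : {set {set 'I_n}}).
Hypothesis ballB : homology_ball R d B.
Implicit Types (F G H s : {set 'I_n}).
Local Notation D := (boundary_complex R B).

Lemma in_link E F G : (G \in link E F) = [disjoint F & G] && (F :|: G \in E).
Proof. by rewrite inE. Qed.

Lemma link_set0 E : link E finset.set0 = E :> {set {set 'I_n}}.
Proof. by apply/setP => G; rewrite in_link finset.set0U finset.disjoints_subset finset.sub0set. Qed.

Lemma link_complex E F : is_complex E -> F \in E -> is_complex (link E F).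
Proof.
move=> [_ subE] FE; split=> [|G H]; rewrite !in_link.
  by rewrite finset.setU0 FE andbT disjoint_sym finset.disjoints_subset finset.sub0set.
move=> /andP[FG GE] HG; rewrite (disjointWr HG) //=.
by apply: subE GE _; exact: finset.setUS.
Qed.

Let complexB : is_complex B. Proof. by case: ballB. Qed.
Let subB F G : F \in B -> G \subset F -> G \in B. Proof. exact: complexB.2. Qed.

Lemma boundary_sub F : F \in D -> F \in B.
Proof. by rewrite inE => /andP[]. Qed.

Lemma boundary_subset F G : F \in D -> G \subset F -> G \in D.
Proof. by case: ballB => _ _ _ _ [[_ + _ _]]; apply. Qed.

Lemma ball_card_le F : F \in B -> (#|F| <= d.+1)%N.
Proof. by case: ballB => _ [+ _] _ _ _ => /[apply]; rewrite /fdim; lia. Qed.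

Lemma boundaryP F : F \in B -> reflect (has_ball_homology R (link B F)) (F \in D).
Proof. by move=> FB; rewrite inE FB; exact: asboolP. Qed.

Lemma interior_link F : F \in B -> F \notin D ->
  has_sphere_homology R (d%:Z - #|F|%:Z) (link B F).
Proof.
move=> FB FD; case: ballB => _ _ ball0 linkB _.
have [F0|F0] := eqVneq F finset.set0.
  by case/boundaryP: FD => //; rewrite F0 link_set0.
by case: (linkB F FB F0) => // /(boundaryP FB); rewrite (negPf FD).
Qed.

(** A maximal face has the link [{set0}], which is not acyclic. The face is therefore interior, and
    its link being a sphere of dimension -1 fixes its number of vertices. *)
Lemma ball_pure F : F \in B -> exists H, [/\ H \in B, F \subset H & #|H| = d.+1].
Proof.
move=> FB; have [H /maxsetP[HB Hmax] FH] := @maxset_exists _ (mem B) F FB.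
exists H; split=> //; have link1 : link B H = [set finset.set0]%SET.
  apply/setP => G; rewrite in_link inE; apply/andP/eqP => [[HG HGB]|->].
    have := Hmax _ HGB (finset.subsetUl _ _) => HU.
    move: HG; rewrite -HU disjoint_sym -setI_eq0 finset.setIC finset.setUC.
    by rewrite finset.setUK => /eqP.
  by rewrite finset.setU0 disjoint_sym finset.disjoints_subset finset.sub0set.
have rb := rbetti_irrelevant R link1.
have HD : H \notin D by apply/boundaryP => // /(_ 0%N); rewrite rb.
have := interior_link HB HD 0%N; rewrite rb.
by case: eqP => // ? _; lia.
Qed.

Lemma ball_link_connected F : F \in B -> (#|F| < d)%N -> rbetti R (link B F) 1 = 0%N.
Proof.
move=> FB Fd; have [/boundaryP -> //|FD] := boolP (F \in D).
by rewrite (interior_link FB FD); case: eqP => // ?; lia.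
Qed.

Lemma ridge_link_card G H : #|G| = d -> H \in link B G -> (#|H| <= 1)%N.
Proof.
move=> Gd; rewrite in_link => /andP[GH /ball_card_le]; rewrite cardsU.
by move: GH; rewrite -setI_eq0 => /eqP ->; rewrite cards0; lia.
Qed.

Lemma in_link1 E G v : ([set v]%SET \in link E G) = (v \notin G) && (v |: G \in E)%SET.
Proof. by rewrite in_link disjoint_sym disjoints1 finset.setUC. Qed.

(** The link of a ridge consists of isolated points; two of them already prevent it from being
    acyclic. *)
Lemma ridge_interior G a b : #|G| = d -> a != b -> a \notin G -> b \notin G ->
  (a |: G \in B)%SET -> (b |: G \in B)%SET -> G \notin D.
Proof.
move=> Gd ab aG bG aB bB; apply/boundaryP => [|/(_ 1%N)].
  exact: subB aB (finset.subsetUr _ _).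
by apply: (@rbetti1_points_neq0 _ _ _ a b) => // [H||]; rewrite ?in_link1 ?aG ?bG //;
  exact: ridge_link_card.
Qed.

Lemma ridge_two G a b v : #|G| = d -> a != b -> a \notin G -> b \notin G ->
  (a |: G \in B)%SET -> (b |: G \in B)%SET -> v \notin G -> (v |: G \in B)%SET ->
  v = a \/ v = b.
Proof.
move=> Gd ab aG bG aB bB vG vB; have [->|va] := eqVneq v a; first by left.
have [->|vb] := eqVneq v b; first by right.
have := interior_link (subB aB (finset.subsetUr _ _)) (ridge_interior Gd ab aG bG aB bB) 1%N.
rewrite Gd !subrr eqxx => rb1.
case: (@rbetti1_points_neq1 R _ (link B G) a b v) => // [H|||||]; rewrite ?in_link1
  ?aG ?bG ?vG // 1?eq_sym //; exact: ridge_link_card.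
Qed.

(** Strong connectivity of the star of [s], phrased as an invariance principle for [Q]. Induction on
    the codimension of [s]: facets that share a vertex [v] outside [s] are compared inside the star
    of [v |: s], and connectedness of the link of [s] leads from a vertex of [F] to a vertex of
    [F']. *)
Lemma ball_strongly_connected s (Q : {set 'I_n} -> Prop) : s \in B ->
    (forall G a b, s \subset G -> #|G| = d -> a != b -> a \notin G -> b \notin G ->
       (a |: G \in B)%SET -> (b |: G \in B)%SET -> Q (a |: G)%SET -> Q (b |: G)%SET) ->
  forall F F', F \in B -> F' \in B -> s \subset F -> s \subset F' ->
    #|F| = d.+1 -> #|F'| = d.+1 -> Q F -> Q F'.
Proof.
move: {2}(d.+1 - #|s|)%N (leqnn (d.+1 - #|s|)) => m.
elim: m s => [|m IH] s sm sB step F F' FB F'B sF sF' Fd F'd.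
  have eqs H : s \subset H -> #|H| = d.+1 -> s = H.
    by move=> sH Hd; apply/eqP; rewrite eqEcard sH Hd; lia.
  by rewrite -(eqs _ sF Fd) -(eqs _ sF' F'd).
(* Here the link of [s] has no edges to walk along. If [s] is a ridge, the two facets differ by one
   vertex and [step] applies directly. *)
have [sd|sd] := leqP d #|s|.
  have [sd1|sd1] := eqVneq #|s| d.+1; first by apply: IH step _ _ FB F'B sF sF' Fd F'd => //; lia.
  have {}sd : #|s| = d by move: (ball_card_le sB); lia.
  have ext H : s \subset H -> #|H| = d.+1 -> exists2 a, a \notin s & H = (a |: s)%SET.
    move=> sH Hd; have : #|H :\: s|%SET = 1%N by rewrite finset.cardsDS // Hd sd; lia.
    move=> /eqP/cards1P[a Ha]; exists a; last first.
      by rewrite -Ha -{1}(finset.setID H s) (finset.setIidPr sH) finset.setUC.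
    have : a \in H :\: s by rewrite Ha set11.
    by rewrite inE => /andP[].
  have [a aG FE] := ext _ sF Fd; have [b bG F'E] := ext _ sF' F'd.
  rewrite FE F'E; have [->//|ab] := eqVneq a b.
  by apply: step => //; rewrite -?FE -?F'E.
have nz H : #|H| = d.+1 -> s \subset H -> exists2 a, a \in H & a \notin s.
  move=> Hd sH; have : (0 < #|H :\: s|%SET)%N by rewrite finset.cardsDS // Hd; lia.
  by move=> /card_gt0P[a]; rewrite inE => /andP[]; exists a.
have [a aF as_] := nz _ Fd sF; have [b bF' bs] := nz _ F'd sF'.
have inB H v : v \in H -> s \subset H -> H \in B -> (v |: s \in B)%SET.
  by move=> vH sH HB; apply: subB HB _; rewrite finset.subUset finset.sub1set vH.
have IHv v H H' : v \notin s -> H \in B -> H' \in B -> s \subset H -> s \subset H' ->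
    v \in H -> v \in H' -> #|H| = d.+1 -> #|H'| = d.+1 -> Q H -> Q H'.
  move=> vs HB H'B sH sH' vH vH' Hd H'd; apply: (IH (v |: s)%SET) => //.
  - by move: sm; rewrite cardsU1 vs add1n subnS; case: (_ - _)%N.
  - exact: inB vH sH HB.
  - by move=> G x y /(fintype.subset_trans (finset.subsetUr _ _)); exact: step.
  - by rewrite finset.subUset finset.sub1set vH.
  - by rewrite finset.subUset finset.sub1set vH'.
move=> QF.
(* The vertices reached by a facet satisfying [Q]. This set is closed along edges of the link,
   because an edge [uv] extends to a facet through both ends, and the induction hypothesis at [u]
   transports [Q] to it. *)
pose S := [set v : 'I_n | (v \notin s) && `[< exists H, [/\ H \in B, #|H| = d.+1,
             s \subset H, v \in H & Q H] >]]%SET.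
have bS : b \in S.
  apply: (@rbetti1_connected R _ (link B s) S a b).
  - exact: link_complex.
  - exact: ball_link_connected.
  - move=> u v; rewrite !inE => /andP[us /asboolP[H [HB Hd sH uH QH]]].
    rewrite disjoint_sym => /andP[] /disjointFl uvs uvB.
    have vs : v \notin s by apply/negP => /uvs; rewrite !inE eqxx orbT.
    rewrite vs; apply/asboolP.
    have [H' [H'B sH' H'd]] := ball_pure uvB; exists H'.
    move: sH'; rewrite !finset.subUset !finset.sub1set => /and3P[sH' uH' vH'].
    by split=> //; apply: (IHv u H).
  - by rewrite in_link1 as_ /=; exact: inB aF sF FB.
  - by rewrite in_link1 bs /=; exact: inB bF' sF' F'B.
  - by rewrite !inE as_; apply/asboolP; exists F.
move: bS; rewrite !inE => /andP[_ /asboolP[H [HB Hd sH bH QH]]].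
exact: (IHv b H).
Qed.

(** Vertices are removed one at a time: an interior face with more than [m] vertices is not a
    missing face of the boundary, so deleting a suitable vertex leaves an interior face. *)
Lemma interior_subface m G : (forall v, [set v]%SET \in B -> [set v]%SET \in D) ->
    (forall F, missing_face D F -> (#|F| <= m)%N) ->
  G \in B -> G \notin D -> (m <= #|G|)%N ->
  exists H, [/\ H \in B, H \notin D, H \subset G & #|H| = m].
Proof.
move=> vertD missD; move: {2}(#|G| - m)%N (erefl (#|G| - m)%N) => e.
elim: e G => [|e IH] G eG GB GD mG; first by exists G; split=> //; lia.
have [v vG vD] : exists2 v, v \in G & (G :\ v \notin D)%SET.
  apply/exists_inP; apply: contraT; rewrite negb_exists_in => /forall_inP GvD.
  suff /missD : missing_face D G by lia.
  split=> // [|H HG].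
    apply/fintype.subsetP => v vG; rewrite inE; apply: vertD.
    by apply: subB GB _; rewrite finset.sub1set.
  have [HsubG [v vG vH]] := properP HG.
  apply: boundary_subset (negbNE (GvD v vG)) _.
  by rewrite finset.subsetD1 HsubG.
have Gv := cardsD1 v G; rewrite vG in Gv.
have [||//||H [HB HD HG Hm]] := IH (G :\ v)%SET.
- by lia.
- by apply: subB GB _; rewrite finset.subD1set.
- by lia.
- by exists H; split=> //; apply: fintype.subset_trans HG (finset.subD1set _ _).
Qed.

End Ball.

(** * Determinants and dual bases *)

Section LinearAlgebra.
Variables (R : realType) (N : nat).
Implicit Types (x y : 'rV[R]_N.+1) (s : seq 'rV[R]_N.+1).

(** Rows come as a list because the sign depends on their order. Absent rows read as 0, and rows
    beyond [N.+1] are ignored. *)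
Definition dets s : R := \det (\matrix_(r < N.+1) nth 0 s r).

Lemma dets_cons s : exists C : 'cV[R]_N.+1, forall x, dets (x :: s) = (x *m C) 0 0.
Proof.
exists (\col_j cofactor (\matrix_(r < N.+1) nth 0 (0 :: s) r) ord0 j) => x.
rewrite /dets (expand_det_row _ ord0) mxE; apply: eq_bigr => j _.
rewrite !mxE /=; congr (_ * (_ * \det _)); apply/matrixP => r k.
by rewrite !mxE lift0.
Qed.

Lemma dets_rot s1 x s2 : (size s1 <= N)%N ->
  dets (s1 ++ x :: s2) = (-1) ^+ size s1 * dets (x :: s1 ++ s2).
Proof.
move=> s1N; rewrite /dets (expand_det_row _ (Ordinal (s1N : (size s1 < N.+1)%N))).
rewrite (expand_det_row _ ord0) mulr_sumr; apply: eq_bigr => j _.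
rewrite !mxE /= nth_cat ltnn subnn /= [RHS]mulrCA; congr (_ * _).
rewrite /cofactor /= exprD -mulrA; congr (_ * (_ * \det _)).
apply/matrixP => r k; rewrite !mxE lift0 /= /bump !nth_cat.
have [rs|rs] := ltnP r (size s1); first by rewrite add0n rs.
by rewrite add1n ltnNge (leq_trans rs (leqnSn _)) /= subSn.
Qed.

Lemma dets_dup x s : (size s <= N)%N -> x \in s -> dets (x :: s) = 0.
Proof.
move=> sN xs; have iN : (index x s < N)%N by apply: leq_trans sN; rewrite index_mem.
apply: (@determinant_alternate _ _ _ ord0 (lift ord0 (Ordinal iN))) => // j.
by rewrite !mxE lift0 /= nth_index.
Qed.

Variables (n : nat) (P : 'I_n -> 'rV[R]_N.+1).
Implicit Types (F : {set 'I_n}) (l : seq 'I_n).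

Definition lin_indep F :=
  forall a : 'I_n -> R, \sum_(v in F) a v *: P v = 0 -> forall v, v \in F -> a v = 0.

Lemma sum_uniq_seq (V : nmodType) F l (f : 'I_n -> V) : uniq l -> l =i F ->
  \sum_(v in F) f v = \sum_(v <- l) f v.
Proof.
move=> ul lF; rewrite -big_enum; apply: perm_big; apply: uniq_perm => //.
  exact: enum_uniq.
by move=> v; rewrite mem_enum lF.
Qed.

Lemma basis_unit F l : lin_indep F -> uniq l -> l =i F -> size l = N.+1 ->
  (\matrix_(r < N.+1) nth 0 (map P l) r) \in unitmx.
Proof.
move=> Ff ul lF sl; rewrite -row_free_unit; apply: inj_row_free => w w0.
have [v0 _] : exists v0, v0 \in l.
  by case: (l) sl => // v0 l' _; exists v0; rewrite mem_head.
apply/rowP => r; rewrite !mxE.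
have rl : (r < size l)%N by rewrite sl.
pose a v := w 0 (inord (index v l)).
have /(_ (nth v0 l r)) : forall v, v \in F -> a v = 0.
  apply: Ff; rewrite (sum_uniq_seq _ ul lF) (big_nth v0) sl big_mkord -[RHS]w0.
  rewrite mulmx_sum_row; apply: eq_bigr => t _.
  have tl : (t < size l)%N by rewrite sl.
  rewrite /a index_uniq // inord_val; congr (_ *: _).
  by rewrite rowK (nth_map v0).
by rewrite /a index_uniq // inord_val => -> //; rewrite -lF mem_nth.
Qed.

Lemma dets_basis F l : lin_indep F -> uniq l -> l =i F -> size l = N.+1 ->
  dets (map P l) != 0.
Proof.
by move=> Ff ul lF sl; have := basis_unit Ff ul lF sl; rewrite unitmxE unitfE.
Qed.

(** The coordinate functionals of the basis [P] on [F] are the columns of the inverse of the matrix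
    of these points. *)
Lemma dual_basis F : lin_indep F -> #|F| = N.+1 ->
  exists e : 'I_n -> 'cV[R]_N.+1,
    (forall u v, u \in F -> v \in F -> (P u *m e v) 0 0 = (u == v)%:R) /\
    (forall x, x = \sum_(v in F) (x *m e v) 0 0 *: P v).
Proof.
move=> Ff FN; pose l := enum F.
have ul : uniq l by exact: enum_uniq.
have lF : l =i F by move=> v; rewrite mem_enum.
have sl : size l = N.+1 by rewrite -cardE.
have := basis_unit Ff ul lF sl; set M := \matrix_(_ < _) _ => Mu.
have [v0 _] : exists v0, v0 \in l.
  by case: (l) sl => // v0 l' _; exists v0; rewrite mem_head.
have PM v : v \in F -> P v = row (inord (index v l)) M.
  rewrite -lF => vl; have vN : (index v l < N.+1)%N by rewrite -sl index_mem.
  by rewrite rowK inordK // (nth_map v0) ?nth_index ?sl.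
exists (fun v => col (inord (index v l)) (invmx M)); split=> [u v uF vF|x].
  rewrite PM // colE mulmxA -row_mul mulmxV // -colE !mxE.
  rewrite -!lF in uF vF.
  congr (nat_of_bool _)%:R; apply/eqP/eqP => [/(congr1 (fun r : 'I_N.+1 => r : nat))|-> //].
  rewrite /= !inordK -?sl ?index_mem // => uv.
  by rewrite -(nth_index v0 uF) -(nth_index v0 vF) uv.
rewrite -{1}(mulmx1 x) -(mulVmx Mu) mulmxA mulmx_sum_row.
rewrite (sum_uniq_seq _ ul lF) (big_nth v0) sl big_mkord; apply: eq_bigr => r _.
have rl : (r < size l)%N by rewrite sl.
rewrite index_uniq // inord_val rowK (nth_map v0) //; congr (_ *: _).
by rewrite !mxE; apply: eq_bigr => j _; rewrite !mxE.
Qed.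

(** The row is taken on the moment curve [(1, t, ..., t^N)]. Pairing it with a nonzero column
    evaluates a nonzero polynomial at [t], and the product of these polynomials has finitely many
    roots. *)
Lemma generic_row (s : seq 'cV[R]_N.+1) : all (fun e => e != 0) s ->
  exists c : 'rV[R]_N.+1, all (fun e => (c *m e) 0 0 != 0) s.
Proof.
move=> s0; pose p := \prod_(e <- s) rVpoly (e : 'cV[R]_N.+1)^T.
have p0 : p != 0.
  rewrite /p prodf_seq_neq0; apply: sub_all s0 => e; apply: contra => /eqP e0.
  by rewrite -[e]trmxK -(rVpolyK e^T) e0 linear0 linear0.
have [t tp] : exists t : R, p.[t] != 0.
  apply: contrapT => nt.
  have /(max_poly_roots p0) : all (root p) [seq j%:R | j <- iota 0 (size p)].
    apply/allP => x _; apply/negPn/negP => px; apply: nt; exists x.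
    exact: px.
  rewrite map_inj_uniq ?iota_uniq; last by move=> a b /eqP; rewrite eqr_nat => /eqP.
  by rewrite size_map size_iota ltnn => /(_ isT).
exists (\row_j t ^+ j); move: tp; rewrite horner_prod prodf_seq_neq0.
apply: sub_all => e /=; rewrite (horner_coef_wide _ (size_poly _ _)) mxE.
congr (_ != 0); apply: eq_bigr => j _.
by rewrite coef_rVpoly_ord !mxE mulrC.
Qed.

End LinearAlgebra.

(** * Weighted sums of powers of linear forms *)

Section LinearForms.
Variables (R : realType) (n : nat).
Implicit Types (a : 'I_n -> R) (q : mpoly n R) (u v : 'I_n).

Definition linform a : mpoly n R := \sum_v a v *: mpolyX R (mnm1 v).

Lemma mcoeff_linform a u : mcoeff (mnm1 u) (linform a) = a u.
Proof.
rewrite raddf_sum /= (bigD1 u) //= big1 ?addr0 => [|v vu].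
  by rewrite mcoeffZ mcoeffX eqxx mulr1.
rewrite mcoeffZ mcoeffX; case: eqP => [/mnmP/(_ u)|]; last by rewrite mulr0.
by rewrite !mnm1E eqxx (negPf vu).
Qed.

Lemma mderiv_linform a u : mderiv u (linform a) = (a u) *: 1.
Proof.
rewrite raddf_sum /= (bigD1 u) //= big1 ?addr0 => [|v vu].
  rewrite mderivZ mderivX mnm1E eqxx scale1r; congr (_ *: _).
  by rewrite -mpolyX0; congr mpolyX; apply/mnmP => w; rewrite mnmBE subnn mnm0E.
by rewrite mderivZ mderivX mnm1E (negPf vu) scale0r scaler0.
Qed.

Lemma mderiv_linform_exp a u r :
  mderiv u (linform a ^+ r.+1) = (r.+1%:R * a u) *: linform a ^+ r.
Proof.
elim: r => [|r IH]; first by rewrite expr1 mderiv_linform mul1r expr0.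
rewrite exprS mderivM mderiv_linform IH -scalerAl mul1r -scalerAr -exprS -scalerDl.
by rewrite -[in RHS]natr1 mulrDl mul1r addrC.
Qed.

Lemma euler_linform_exp a r :
  \sum_u mpolyX R (mnm1 u) * mderiv u (linform a ^+ r.+1) = r.+1%:R *: linform a ^+ r.+1.
Proof.
under eq_bigr => u _ do rewrite mderiv_linform_exp -scalerAr -scalerA scalerAl.
rewrite -scaler_sumr; congr (_ *: _).
by rewrite exprS {2}/linform mulr_suml.
Qed.

Definition supported (F : {set 'I_n}) q :=
  forall m, m \in msupp q -> forall v, m v != 0%N -> v \in F.

Lemma supported_linform_exp (F : {set 'I_n}) a r :
  (forall v, v \notin F -> a v = 0) -> supported F (linform a ^+ r).
Proof.
move=> aF; elim: r => [|r IH] m.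
  by rewrite expr0 msupp1 inE => /eqP -> v; rewrite mnm0E.
rewrite exprS => /msuppM_le/allpairsP[[m1 m2] /= [m1s m2s ->]] v.
rewrite mnmDE addn_eq0 negb_and => /orP[|/(IH _ m2s)//].
move: m1s => /msupp_sum_le/flattenP[s /mapP[w]].
rewrite mem_filter /= => _ ->; have [wF|/aF ->] := boolP (w \in F).
  move=> /msuppZ_le; rewrite msuppX inE => /eqP ->.
  by rewrite mnm1E eqb0 negbK => /eqP <-.
by rewrite scale0r msupp0.
Qed.

Lemma dhomog_linform_exp a r : linform a ^+ r \is @ishomog1 n R r mdeg.
Proof.
rewrite -[X in @ishomog1 _ _ X]mul1n; apply: dhomogMn; apply: rpred_sum => v _.
by apply: rpredZ; rewrite dhomogX; apply/eqP; exact: mdeg1.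
Qed.

End LinearForms.

(** * Weighted powers of linear forms over a family of sets *)

Section StackedForms.
Variables (R : realType) (n d : nat) (P : 'I_n -> 'rV[R]_d).
Variables (A : {set 'I_n}) (fam : {set {set 'I_n}}) (i : nat).
Variables (c : 'rV[R]_d) (b : {set 'I_n} -> 'I_n -> R) (kap : {set 'I_n} -> R).
Hypothesis fam_card : forall S, S \in fam -> #|S| = i.+1.
Hypothesis b_supp : forall S v, S \in fam -> v \notin A :|: S -> b S v = 0.
Hypothesis b_neq0 : forall S v, S \in fam -> v \in S -> b S v != 0.
Hypothesis b_sum : forall S, S \in fam -> \sum_v b S v *: P v = c.
Hypothesis kap_ridge : forall T : {set 'I_n}, #|T| = i ->
  \sum_(v | (v \notin T) && (v |: T \in fam)%SET) kap (v |: T)%SET / b (v |: T)%SET v = 0.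
Hypothesis functional : forall S (T : {set 'I_n}) u, S \in fam -> T \proper S ->
  u \in A :|: T -> exists th : 'cV[R]_d,
    [/\ forall w, w \in A :|: T -> (P w *m th) 0 0 = (w == u)%:R & (c *m th) 0 0 = 0].

(** For empty [T] this is the polynomial of the stress. For larger [T] it is, up to a scalar, a
    derivative of it along [T], which is why the product runs over [S :\: T] only. *)
Definition famform (T : {set 'I_n}) (r : nat) : mpoly n R :=
  \sum_(S in fam | T \subset S) (kap S / \prod_(v in S :\: T) b S v) *: linform (b S) ^+ r.

(** Terms with [u] outside [S] do not involve [u]. In the others, differentiation yields a factor
    [b S u], which cancels one factor of the denominator. *)
Lemma mderiv_famform (T : {set 'I_n}) u r : u \notin A -> u \notin T ->
  mderiv u (famform T r.+1) = r.+1%:R *: famform (u |: T)%SET r.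
Proof.
move=> uA uT; rewrite raddf_sum /= scaler_sumr big_mkcond [RHS]big_mkcond /=.
apply: eq_bigr => S _; rewrite finset.subUset finset.sub1set.
case: ifPn => [/andP[SF TS]|]; last first.
  by case: ifPn => // /and3P[-> _ ->].
rewrite SF TS andbT /= mderivZ mderiv_linform_exp scalerA.
case: ifPn => uS; last by rewrite b_supp ?mulr0 ?scale0r // inE negb_or uA.
rewrite (big_setD1 u) /=; last by rewrite inE uT.
rewrite scalerA; congr (_ *: _).
have -> : (S :\: T :\ u = S :\: (u |: T))%SET.
  by apply/setP => v; rewrite !inE negb_or andbA.
rewrite invfM; have := mulVf (b_neq0 SF uS); set y := _^-1; set p := _^-1 => yb.
transitivity (r.+1%:R * (kap S * p) * (y * b S u)); first by ring.
by rewrite yb mulr1.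
Qed.

(** Each summand is multiplied by the value of [th] on [\sum_v b S v *: P v], and this point is [c]
    for every [S]. *)
Lemma theta_famform (T : {set 'I_n}) (th : 'cV[R]_d) r :
  \sum_u (P u *m th) 0 0 *: mderiv u (famform T r.+1) =
  (r.+1%:R * (c *m th) 0 0) *: famform T r.
Proof.
rewrite /famform; under eq_bigr => u _ do rewrite (linear_sum (mderiv u)) scaler_sumr.
rewrite exchange_big /= scaler_sumr; apply: eq_bigr => S /andP[SF TS].
rewrite -(b_sum SF) mulmx_suml summxE.
under eq_bigr => u _ do rewrite mderivZ mderiv_linform_exp !scalerA.
rewrite -scaler_suml scalerA; congr (_ *: _).
rewrite mulr_sumr mulr_suml; apply: eq_bigr => u _.
rewrite -scalemxAl [(_ *: (_ *m _)) _ _]mxE.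
by move: ((P u *m th) 0 0) (_ / _) => y k; ring.
Qed.

Lemma euler_famform (T : {set 'I_n}) r :
  \sum_u mpolyX R (mnm1 u) * mderiv u (famform T r.+1) = r.+1%:R *: famform T r.+1.
Proof.
rewrite /famform; under eq_bigr => u _ do rewrite (linear_sum (mderiv u)) mulr_sumr.
rewrite exchange_big /= scaler_sumr; apply: eq_bigr => S _.
under eq_bigr => u _ do rewrite mderivZ -scalerAr.
by rewrite -scaler_sumr euler_linform_exp !scalerA mulrC.
Qed.

(** With exponent 0 only the scalar coefficients remain. The sets of the family above [T] are the
    [v |: T], so their sum is the one in [kap_ridge]. *)
Lemma famform_ridge (T : {set 'I_n}) : #|T| = i -> famform T 0 = 0.
Proof.
move=> Ti; rewrite /famform; under eq_bigr => S _ do rewrite expr0.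
rewrite -scaler_suml.
suff -> : \sum_(S in fam | T \subset S) kap S / \prod_(v in S :\: T) b S v =
    \sum_(v | (v \notin T) && (v |: T \in fam)%SET) kap (v |: T)%SET / b (v |: T)%SET v.
  by rewrite kap_ridge // scale0r.
transitivity (\sum_(S in fam | T \subset S) \sum_(v in S :\: T) kap S / b S v).
  apply: eq_bigr => S /andP[SF TS].
  have /eqP/cards1P[v ->] : #|S :\: T|%SET = 1%N.
    by rewrite finset.cardsDS // fam_card // Ti subSn // subnn.
  by rewrite !big_set1.
rewrite (exchange_big_dep (fun v => v \notin T)) /=; last first.
  by move=> S v _; rewrite inE => /andP[].
rewrite [RHS]big_mkcondr /=; apply: eq_bigr => v vT.
have E S : [&& S \in fam, T \subset S & v \in S :\: T] =
    (S == v |: T)%SET && (v |: T \in fam)%SET.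
  rewrite inE vT /=; apply/and3P/andP => [[SF TS vS]|[/eqP -> ->]]; last first.
    by split; rewrite ?finset.subsetUr ?setU11.
  suff SE : S = (v |: T)%SET by rewrite -SE eqxx.
  apply/eqP; rewrite eq_sym eqEcard finset.subUset finset.sub1set vS TS /=.
  by rewrite fam_card // cardsU1 vT Ti.
under eq_bigl => S do rewrite -andbA E.
case: ifPn => vF; last by rewrite big_pred0 // => S; rewrite andbF.
by under eq_bigl => S do rewrite andbT; rewrite big_pred1_eq.
Qed.

(* All partial derivatives vanish: outside A U T by induction, and inside because some
   functional singles out the given vertex among P(A U T) and kills c.  Conclude by
   Euler's identity. *)
Lemma famform_eq0 (T : {set 'I_n}) r : (#|T| + r)%N = i -> famform T r = 0.
Proof.
elim: r T => [|r IH] T Ti; first by rewrite famform_ridge -?Ti ?addn0.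
have [S /andP[SF TS]|noS] := pickP (fun S => (S \in fam) && (T \subset S)); last first.
  by rewrite /famform big_pred0.
have TpS : T \proper S.
  by rewrite properEcard TS (fam_card SF) -Ti ltnS leq_addr.
have dfree u : u \notin A -> u \notin T -> mderiv u (famform T r.+1) = 0.
  by move=> uA uT; rewrite mderiv_famform // IH ?scaler0 // cardsU1 uT -Ti add1n addSnnS.
have d0 u : mderiv u (famform T r.+1) = 0.
  have [uAT|] := boolP (u \in A :|: T); last first.
    by rewrite inE negb_or => /andP[]; exact: dfree.
  have [th [thP thc]] := functional SF TpS uAT.
  have := theta_famform T th r; rewrite thc mulr0 scale0r (bigD1 u) //=.
  rewrite thP // eqxx scale1r big1 ?addr0 // => w wu.
  have [wAT|] := boolP (w \in A :|: T); first by rewrite thP // (negPf wu) scale0r.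
  by rewrite inE negb_or => /andP[wA wT]; rewrite dfree // scaler0.
have /esym/eqP := euler_famform T r.
rewrite big1 => [|u _]; last by rewrite d0 mulr0.
by rewrite scaler_eq0 pnatr_eq0 => /eqP.
Qed.

Definition seq_mon (l : seq 'I_n) : multinom n :=
  foldr (fun v m => mnm_add (mnm1 v) m) (@mnm0 n) l.

Lemma mderivm_famform (T : {set 'I_n}) l r : uniq l ->
    (forall v, v \in l -> v \notin A /\ v \notin T) ->
  exists2 k : R, k != 0 &
    mderivm (seq_mon l) (famform T (size l + r)) = k *: famform ([set:: l] :|: T)%SET r.
Proof.
elim: l T => [|v l IH] T.
  move=> _ _; exists 1; first exact: oner_neq0.
  rewrite mderivm0m scale1r; congr famform.
  by apply/setP => w; rewrite !inE.
move=> /= /andP[vl ul] lAT; have [vA vT] := lAT v (mem_head _ _).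
have [w wl|k k0 Ek] := IH (v |: T)%SET ul.
  have [wA wT] := lAT w (@mem_behead _ (v :: l) _ wl); split=> //.
  by rewrite !inE negb_or wT andbT; apply: contraNneq vl => <-.
exists ((size l + r).+1%:R * k); first by rewrite mulf_neq0 // pnatr_eq0.
rewrite mderivmDm mderivmU1m addSn mderiv_famform // mderivmZ Ek scalerA.
congr (_ *: famform _ _); apply/setP => w; rewrite !inE; by do !case: (_ == _); do !case: (_ \in _).
Qed.

End StackedForms.

(** * The stress on the star of an interior face *)

Section EnumSetU1.
Variable n : nat.

(** Links the position of [v] in an ordered list of rows to the exponent of the sign in the
    simplicial boundary. *)
Lemma enum_setU1 (T : {set 'I_n}) (v : 'I_n) : v \notin T -> exists s1 s2,
  [/\ enum (v |: T)%SET = s1 ++ v :: s2, enum T = s1 ++ s2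
    & size s1 = #|[set u in T | (u < v)%N]%SET|].
Proof.
move=> vT; pose l1 := take v (enum 'I_n); pose l2 := drop v.+1 (enum 'I_n).
have El : enum 'I_n = l1 ++ v :: l2.
  rewrite -{1}(cat_take_drop v (enum 'I_n)) (drop_nth v) ?size_enum_ord //.
  by rewrite nth_ord_enum.
have : uniq (enum 'I_n) by exact: enum_uniq.
rewrite El cat_uniq /= negb_or => /and4P[ul1 /andP[vl1 _] vl2 _].
have filt l : v \notin l -> seq.filter (fun w => w \in (v |: T)%SET) l = seq.filter (fun w => w \in T) l.
  move=> vl; apply: eq_in_filter => w wl; rewrite !inE.
  by case: eqVneq => // wv; rewrite -wv wl in vl.
have filtE (F : {set 'I_n}) : enum F = seq.filter (fun w => w \in F) (enum 'I_n).
  by rewrite /enum_mem filter_predT.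
exists (seq.filter (fun w => w \in T) l1), (seq.filter (fun w => w \in T) l2); split.
- by rewrite filtE El filter_cat /= setU11 !filt.
- by rewrite filtE El filter_cat /= (negPf vT).
rewrite -(card_uniqP _) ?filter_uniq //; apply: eq_card => u.
by rewrite mem_filter !inE in_take ?mem_enum // index_enum_ord.
Qed.

End EnumSetU1.

Lemma linform_sum (R : realType) n (I : finType) (Q : pred I) (k : I -> R)
    (a : I -> 'I_n -> R) :
  \sum_(j | Q j) k j *: linform (a j) = linform (fun v => \sum_(j | Q j) k j * a j v).
Proof.
rewrite /linform; under eq_bigr => j _ do rewrite scaler_sumr.
rewrite exchange_big; apply: eq_bigr => v _; rewrite scaler_suml.
by apply: eq_bigr => j _; rewrite scalerA.
Qed.


Section RidgeStress.
Variables (R : realType) (n d e : nat) (B : {set {set 'I_n}}) (A : {set 'I_n}).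
Variable P : 'I_n -> 'rV[R]_d.+1.
Hypothesis ballB : homology_ball R d B.
Local Notation D := (boundary_complex R B).
Hypothesis facet_indep : forall F, F \in B -> #|F| = d.+1 -> lin_indep P F.
Hypotheses (AB : A \in B) (AD : A \notin D) (cardA : (#|A| + e)%N = d).
Implicit Types (F G S T : {set 'I_n}).

Let fam : {set {set 'I_n}} := [set S in link B A | #|S| == e.+1]%SET.

Let subB F G : F \in B -> G \subset F -> G \in B.
Proof. by case: ballB => [[_ +] _ _ _ _]; apply. Qed.

Let famP S : S \in fam -> [/\ [disjoint A & S]%B, A :|: S \in B, #|S| = e.+1
  & #|A :|: S| = d.+1].
Proof.
rewrite inE in_link => /andP[/andP[AS ASB] /eqP Se]; split=> //.
by move: AS; rewrite cardsU -setI_eq0 => /eqP ->; rewrite cards0 subn0 Se addnS cardA.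
Qed.

Let in_fam T v : #|T| = e -> [disjoint A & T]%B -> v \notin A -> v \notin T ->
  (v |: (A :|: T) \in B)%SET -> (v |: T \in fam)%SET.
Proof.
move=> Te AT vA vT vB; rewrite inE in_link cardsU1 vT Te eqxx andbT.
rewrite finset.setUCA vB andbT disjoint_sym -setI_eq0 finset.setIUl finset.setU_eq0.
by rewrite !setI_eq0 disjoints1 vA disjoint_sym.
Qed.

Let fam_ext T S v : #|T| = e -> S \in fam -> T \subset S -> v \in S -> v \notin T ->
  S = (v |: T)%SET.
Proof.
move=> Te /famP[_ _ Se _] TS vS vT; apply/eqP.
by rewrite eq_sym eqEcard finset.subUset finset.sub1set vS TS cardsU1 vT Te Se add1n leqnn.
Qed.

(** The link of [A] is a homology sphere of dimension [e], whence a nonzero top cycle. Its support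
    is all of [fam]: across a ridge the cycle relation has only two terms, so nonvanishing spreads
    through the strongly connected star of [A]. *)
Lemma interior_cycle : exists z : {ffun {set 'I_n} -> R^o},
  [/\ forall S, z S != 0 <-> S \in fam
    & forall T, \sum_(v | v \notin T)
        (-1) ^+ #|[set u in T | (u < v)%N]%SET| * z (v |: T)%SET = 0].
Proof.
have rb : rbetti R (link B A) e.+1 = 1%N.
  by rewrite (interior_link ballB AB AD) -cardA; case: eqP => // ne; exfalso; apply: ne; lia.
have [z /mem_chains zE [bdz z0]] := rbetti1_cycle rb.
have zT T : \sum_(v | v \notin T)
    (-1) ^+ #|[set u in T | (u < v)%N]%SET| * z (v |: T)%SET = 0.
  by rewrite -bdE bdz ffunE.
have zfam S : z S != 0 -> S \in fam.
  by move=> /zE[SL Se]; rewrite inE SL Se eqxx.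
exists z; split=> // S; split=> [/zfam//|SF].
have [S0 zS0] : exists S0, z S0 != 0.
  apply: contrapT => nz; move/eqP: z0; apply; apply/ffunP => S0; rewrite [RHS]ffunE.
  by apply: contrapT => /eqP zS0; apply: nz; exists S0.
have SA S1 : S1 \in fam -> ((A :|: S1) :\: A = S1)%SET.
  move=> /famP[+ _ _ _]; rewrite disjoint_sym => dS.
  rewrite finset.setDUl finset.setDv finset.set0U; apply/finset.setDidPl.
  exact: dS.
have [_ S0B S0e S0d] := famP (zfam _ zS0); have [_ SB Se Sd] := famP SF.
rewrite -(SA S SF).
apply: (@ball_strongly_connected _ _ _ _ ballB A (fun F => z (F :\: A)%SET != 0) AB
  _ (A :|: S0) (A :|: S)) => //; rewrite ?finset.subsetUl ?SA //; last exact: zfam.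
move=> G a b AG Gd ab aG bG aB bB.
pose T := (G :\: A)%SET.
have GE : (A :|: T)%SET = G by rewrite -[RHS](finset.setID G A) (finset.setIidPr AG).
have vUT v : v \notin G -> ((v |: G) :\: A = v |: T)%SET.
  move=> vG; have vA : v \notin A by apply: contraNN vG => /(fintype.subsetP AG).
  by rewrite finset.setDUl; congr (_ :|: _); apply/finset.setDidPl; rewrite disjoints1.
rewrite !vUT //; apply: contra_neqN => /eqP zb; move: (zT T).
have aT : a \notin T by rewrite inE (negPf aG) andbF.
rewrite (bigD1 a) //= big1 ?addr0 => [/eqP|v /andP[vT va]].
  by rewrite mulf_eq0 signr_eq0 => /eqP.
have [->|zv] := eqVneq (z (v |: T)%SET) 0; first by rewrite mulr0.
have [Av vB _ _] := famP (zfam _ zv).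
have vA : v \notin A by rewrite (disjointFl Av) // setU11.
have vG : v \notin G by rewrite -GE inE negb_or vA.
rewrite finset.setUCA GE in vB.
have [E|E] := ridge_two ballB Gd ab aG bG aB bB vG vB; first by rewrite E eqxx in va.
by rewrite E zb mulr0.
Qed.

Lemma facet_duals : exists E : {set 'I_n} -> 'I_n -> 'cV[R]_d.+1,
  forall F, F \in B -> #|F| = d.+1 ->
    (forall u v, u \in F -> v \in F -> (P u *m E F v) 0 0 = (u == v)%:R) /\
    (forall x, x = \sum_(v in F) (x *m E F v) 0 0 *: P v).
Proof.
pose dual F (E : 'I_n -> 'cV[R]_d.+1) :=
  (forall u v, u \in F -> v \in F -> (P u *m E v) 0 0 = (u == v)%:R) /\
  (forall x, x = \sum_(v in F) (x *m E v) 0 0 *: P v).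
suff /boolp.choice[E EP] : forall F, exists E, F \in B -> #|F| = d.+1 -> dual F E.
  by exists E.
move=> F.
have [/andP[FB /eqP Fd]|] := boolP ((F \in B) && (#|F| == d.+1)).
  by have [E] := dual_basis (facet_indep FB Fd) Fd; exists E.
by rewrite negb_and => /orP[/negPf FB|/eqP Fd]; exists (fun=> 0); rewrite ?FB.
Qed.

Lemma generic_point (E : {set 'I_n} -> 'I_n -> 'cV[R]_d.+1) :
    (forall F, F \in B -> #|F| = d.+1 ->
      forall u v, u \in F -> v \in F -> (P u *m E F v) 0 0 = (u == v)%:R) ->
  exists c : 'rV[R]_d.+1, forall F v, F \in B -> #|F| = d.+1 -> v \in F ->
    (c *m E F v) 0 0 != 0.
Proof.
move=> EP; pose Q (x : {set 'I_n} * 'I_n) :=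
  [&& x.1 \in B, #|x.1| == d.+1 & x.2 \in x.1].
(* Pairs that are not a facet with one of its vertices receive the dummy column [const_mx 1], so
   that no entry of the list is zero. *)
have [|c /allP cP] := @generic_row R d
    [seq (if Q x then E x.1 x.2 else const_mx 1) | x <- enum {: {set 'I_n} * 'I_n}].
  apply/allP => _ /mapP[[F v] _ ->]; case: ifPn => [/and3P[/= FB /eqP Fd vF]|_].
    apply/eqP => E0; have := EP F FB Fd v v vF vF.
    by rewrite E0 mulmx0 mxE eqxx => /eqP; rewrite eq_sym oner_eq0.
  by apply/eqP => /matrixP/(_ 0 0)/eqP; rewrite !mxE oner_eq0.
exists c => F v FB Fd vF; apply: cP; apply/mapP; exists (F, v); rewrite ?mem_enum //.
by rewrite /Q /= FB Fd eqxx vF.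
Qed.

Section Coordinates.
Variables (E : {set 'I_n} -> 'I_n -> 'cV[R]_d.+1) (c : 'rV[R]_d.+1).
Variable z : {ffun {set 'I_n} -> R^o}.
Hypothesis E_dual : forall F, F \in B -> #|F| = d.+1 ->
  forall u v, u \in F -> v \in F -> (P u *m E F v) 0 0 = (u == v)%:R.
Hypothesis E_sum : forall F, F \in B -> #|F| = d.+1 ->
  forall x, x = \sum_(v in F) (x *m E F v) 0 0 *: P v.
Hypothesis c_generic : forall F v, F \in B -> #|F| = d.+1 -> v \in F ->
  (c *m E F v) 0 0 != 0.
Hypothesis z_supp : forall S, z S != 0 <-> S \in fam.
Hypothesis z_cycle : forall T, \sum_(v | v \notin T)
  (-1) ^+ #|[set u in T | (u < v)%N]%SET| * z (v |: T)%SET = 0.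

Let b S v : R := if v \in A :|: S then (c *m E (A :|: S) v) 0 0 else 0.
Let kap S : R := z S / dets (map P (enum A ++ enum S)).

Let b_supp S v : S \in fam -> v \notin A :|: S -> b S v = 0.
Proof. by rewrite /b => _ /negPf ->. Qed.

Let b_in S v : v \in A :|: S -> b S v = (c *m E (A :|: S) v) 0 0.
Proof. by rewrite /b => ->. Qed.

Let b_neq0 S v : S \in fam -> v \in S -> b S v != 0.
Proof.
move=> /famP[_ SB _ Sd] vS; have vAS : v \in A :|: S by rewrite inE vS orbT.
by rewrite b_in // c_generic.
Qed.

Let b_sum S : S \in fam -> \sum_v b S v *: P v = c.
Proof.
move=> /famP[_ SB _ Sd]; rewrite [RHS](E_sum SB Sd) [RHS]big_mkcond /=.
by apply: eq_bigr => v _; rewrite /b; case: ifP; rewrite ?scale0r.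
Qed.

Let dets_fam S : S \in fam -> dets (map P (enum A ++ enum S)) != 0.
Proof.
move=> SF; have [AS SB Se Sd] := famP SF; apply: (dets_basis (facet_indep SB Sd)).
- rewrite cat_uniq !enum_uniq andbT /=; apply/hasPn => v; rewrite !mem_enum => vS.
  by rewrite (disjointFl AS vS).
- by move=> v; rewrite mem_cat !mem_enum inE.
- by rewrite size_cat -!cardE Se addnS cardA.
Qed.

Let kap_neq0 S : S \in fam -> kap S != 0.
Proof. by move=> SF; rewrite mulf_neq0 ?invr_eq0 ?dets_fam // z_supp. Qed.

(* By Cramer's rule kap / b is, up to a common factor, z with the sign it has in the
   boundary map, so that the sum is the coefficient of T in the boundary of z. *)
Let kap_ridge T : #|T| = e ->
  \sum_(v | (v \notin T) && (v |: T \in fam)%SET) kap (v |: T)%SET / b (v |: T)%SET v = 0.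
Proof.
move=> Te; have [C CP] := dets_cons (map P (enum A ++ enum T)).
transitivity (((-1) ^+ #|A| / (c *m C) 0 0) * \sum_(v | v \notin T)
    (-1) ^+ #|[set u in T | (u < v)%N]%SET| * (z (v |: T)%SET : R)); last first.
  by rewrite z_cycle mulr0.
rewrite mulr_sumr [RHS](bigID (fun v => v |: T \in fam)%SET) /= [X in _ + X]big1 ?addr0.
  apply: eq_bigr => v /andP[vT vF].
  have [s1 [s2 [Ev ET s1E]]] := enum_setU1 vT.
  have [AS SB Se Sd] := famP vF.
  have sz : (#|A| + size s1 <= d)%N.
    by rewrite -cardA leq_add2l -Te cardE ET size_cat leq_addr.
  (* Bringing the row of [v] to the front crosses all of [A] and the elements of [T] below [v]. The
     first sign is common to all terms; the second is the boundary sign. *)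
  have Dv : dets (map P (enum A ++ enum (v |: T)%SET)) =
      (-1) ^+ #|A| * (-1) ^+ size s1 * (P v *m C) 0 0.
    rewrite Ev catA map_cat /= dets_rot; last by rewrite size_map size_cat -cardE.
    by rewrite -map_cat -catA -ET -CP size_map size_cat -cardE exprD.
  have cC : (c *m C) 0 0 = b (v |: T)%SET v * (P v *m C) 0 0.
    rewrite -{1}(b_sum vF) mulmx_suml summxE (bigD1 v) //= big1 ?addr0 => [|u uv].
      by rewrite -scalemxAl mxE.
    rewrite -scalemxAl mxE; have [uAT|uAT] := boolP (u \in A :|: (v |: T)%SET).
      rewrite -CP dets_dup ?mulr0 //.
        by rewrite size_map size_cat -!cardE Te cardA.
      apply: map_f; rewrite mem_cat !mem_enum.
      by move: uAT; rewrite !inE (negPf uv).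
    by rewrite b_supp // mul0r.
  have bv : b (v |: T)%SET v != 0 by rewrite b_neq0 // setU11.
  have := dets_fam vF; rewrite Dv mulf_eq0 negb_or => /andP[sgn0 Pv0].
  rewrite /kap Dv cC -s1E !invfM ?invr_sign.
  by move: (b _ _)^-1 ((P v *m C) 0 0)^-1 => x y; ring.
move=> v /andP[vT vF]; have [->|/z_supp] := eqVneq (z (v |: T)%SET) 0.
  by rewrite !mulr0.
by rewrite (negPf vF).
Qed.

Let functional S T u : S \in fam -> T \proper S -> u \in A :|: T ->
  exists th : 'cV[R]_d.+1,
    [/\ forall w, w \in A :|: T -> (P w *m th) 0 0 = (w == u)%:R & (c *m th) 0 0 = 0].
Proof.
move=> SF TpS uAT; have [AS SB Se Sd] := famP SF.
have [TS [v vS vT]] := properP TpS.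
have sub w : w \in A :|: T -> w \in A :|: S.
  by rewrite !inE => /orP[->//|/(fintype.subsetP TS) ->]; rewrite orbT.
have vAS : v \in A :|: S by rewrite inE vS orbT.
have vAT : v \notin A :|: T by rewrite inE negb_or vT andbT (disjointFl AS vS).
have bv := c_generic SB Sd vAS.
(* Start from the coordinate of [u] and subtract the multiple of the coordinate of [v] that makes
   [c] vanish. As [v] lies in [S] but not in [A :|: T], values on [A :|: T] are unchanged; the
   division is legitimate since [c] is generic. *)
exists (E (A :|: S) u - ((c *m E (A :|: S) u) 0 0 / (c *m E (A :|: S) v) 0 0)
  *: E (A :|: S) v); split=> [w wAT|].
  rewrite mulmxBr -scalemxAr [LHS]mxE [X in _ + X]mxE [X in - X]mxE !E_dual ?(sub _ uAT) ?(sub _ wAT) ?vAS //.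
  case: (eqVneq w v) => [wv|_]; first by rewrite -wv wAT in vAT.
  by rewrite mulr0 subr0.
by rewrite mulmxBr -scalemxAr [LHS]mxE [X in _ + X]mxE [X in - X]mxE divfK ?subrr.
Qed.

Let w := famform fam b kap finset.set0 e.+1.

(** Differentiating along [G :\: A] leaves a linear form with one summand for each facet of [B]
    through [G]. There are two such facets, so the form lives on [a0], [b0] and [G], and [b0] occurs
    in only one summand. *)
Lemma ridge_stress_coord G a0 b0 : A \subset G -> #|G| = d ->
    a0 != b0 -> a0 \notin G -> b0 \notin G -> (a0 |: G \in B)%SET -> (b0 |: G \in B)%SET ->
  [/\ w \is @ishomog1 n R e.+1 mdeg,
      forall m, m \in msupp w -> exists2 F, F \in B & forall v, m v != 0%N -> v \in F,
      forall th : 'cV[R]_d.+1, \sum_u (P u *m th) 0 0 *: mderiv u w = 0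
    & exists x : 'I_n -> R,
        [/\ mderivm (seq_mon (enum (G :\: A)%SET)) w = linform x, x b0 != 0
          & forall v, v \notin (a0 |: (b0 |: G))%SET -> x v = 0]].
Proof.
move=> AG Gd ab aG bG aB bB.
pose T := (G :\: A)%SET.
have fam_card S : S \in fam -> #|S| = e.+1 by case/famP.
have GE : (A :|: T)%SET = G by rewrite -[RHS](finset.setID G A) (finset.setIidPr AG).
have Te : #|T| = e by rewrite finset.cardsDS // Gd -cardA addKn.
have AT : [disjoint A & T]%B.
  by rewrite finset.disjoints_subset; apply/fintype.subsetP => v vA; rewrite !inE vA.
split.
- apply: rpred_sum => S _; apply: rpredZ; exact: dhomog_linform_exp.
- move=> m /msupp_sum_le/flattenP[s /mapP[S]]; rewrite mem_filter => /andP[/andP[SF _] _] ->.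
  move=> /msuppZ_le mS; exists (A :|: S); first by case/famP: SF.
  apply: supported_linform_exp mS => v; exact: b_supp.
- move=> th; rewrite (theta_famform _ b_sum) (famform_eq0 fam_card b_supp b_neq0 b_sum kap_ridge functional).
    by rewrite scaler0.
  by rewrite cards0.
(* The exponent is [e.+1] and [T] has [e] elements, so these derivatives leave exponent 1. *)
have [||k k0 Ek] := mderivm_famform kap b_supp b_neq0 (T := finset.set0) (l := enum T) 1%N.
- exact: enum_uniq.
- by move=> v; rewrite mem_enum !inE => /andP[].
exists (fun v => \sum_(S in fam | T \subset S)
  k * (kap S / \prod_(v in S :\: T) b S v) * b S v); split.
- rewrite -linform_sum /w -[e.+1]addn1 -[in X in famform _ _ _ _ X]Te cardE Ek /famform scaler_sumr.
  have -> : ([set:: enum T] :|: finset.set0 = T)%SET.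
    by apply/setP => v; rewrite !inE mem_enum orbF inE.
  by apply: eq_bigr => S _; rewrite scalerA expr1.
- have bT : b0 \notin T by rewrite inE (negPf bG) andbF.
  have bA : b0 \notin A by apply: contraNN bG => /(fintype.subsetP AG).
  have bF : (b0 |: T \in fam)%SET by apply: in_fam; rewrite // GE.
  rewrite (bigD1 (b0 |: T)%SET) /=; last by rewrite bF finset.subsetUr.
  have -> : ((b0 |: T) :\: T = [set b0])%SET.
    by rewrite finset.setDUl finset.setDv finset.setU0; apply/finset.setDidPl; rewrite disjoints1.
  rewrite big_set1 big1 ?addr0 => [|S /andP[/andP[SF TS] Sb]].
    by rewrite -mulrA mulf_neq0 // divfK ?kap_neq0 // b_neq0 // setU11.
  rewrite b_supp ?mulr0 // inE negb_or bA; apply: contra_neqN Sb => bS.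
  exact: fam_ext.
- move=> v vab; apply: big1 => S /andP[SF TS]; rewrite b_supp ?mulr0 //.
  move: vab; rewrite !inE !negb_or => /and3P[va vb vG].
  have vA : v \notin A by apply: contraNN vG => /(fintype.subsetP AG).
  rewrite vA /=; apply/negP => vS.
  have vT : v \notin T by rewrite inE (negPf vG) andbF.
  have [_ SB _ _] := famP SF; rewrite (fam_ext Te SF TS vS vT) finset.setUCA GE in SB.
  by have [E1|E1] := ridge_two ballB Gd ab aG bG aB bB vG SB; rewrite E1 eqxx in va vb.
Qed.

End Coordinates.

Lemma ridge_stress G a b : A \subset G -> #|G| = d ->
    a != b -> a \notin G -> b \notin G -> (a |: G \in B)%SET -> (b |: G \in B)%SET ->
  exists w : mpoly n R,
  [/\ w \is @ishomog1 n R e.+1 mdeg,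
      forall m, m \in msupp w -> exists2 F, F \in B & forall v, m v != 0%N -> v \in F,
      forall th : 'cV[R]_d.+1, \sum_u (P u *m th) 0 0 *: mderiv u w = 0
    & exists x : 'I_n -> R,
        [/\ mderivm (seq_mon (enum (G :\: A)%SET)) w = linform x, x b != 0
          & forall v, v \notin (a |: (b |: G))%SET -> x v = 0]].
Proof.
have [E EP] := facet_duals; have [z [zS zT]] := interior_cycle.
have E_dual F FB Fd := (EP F FB Fd).1; have E_sum F FB Fd := (EP F FB Fd).2.
have [c cP] := generic_point E_dual.
move=> AG Gd ab aG bG aB bB; eexists.
exact: (ridge_stress_coord E_dual E_sum cP zS zT AG Gd ab aG bG aB bB).
Qed.

End RidgeStress.

(** * Affine stresses and homogenized points *)

Section FiniteSpan.
Variables (R : realType) (n : nat).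

(** Double annihilator in finite dimension: the columns of the cokernel matrix of the stacked rows
    [f t] are themselves test vectors [h]. *)
Lemma span_of_annihilator (I : finType) (f : I -> 'rV[R]_n) (x : 'rV[R]_n) :
    (forall h : 'cV[R]_n, (forall t, f t *m h = 0) -> x *m h = 0) ->
  exists a : I -> R, x = \sum_t a t *: f t.
Proof.
move=> xf; pose M := \matrix_(j < #|I|) f (enum_val j).
have /submxP[a xE] : (x <= M)%MS.
  rewrite submxE; apply/eqP/matrixP => i j; rewrite ord1 [RHS]mxE.
  have : x *m col j (cokermx M) = 0.
    apply: xf => t; rewrite -(enum_rankK t) -[f _](rowK (fun j => f (enum_val j))).
    by rewrite -row_mul -/M colE mulmxA mulmx_coker mul0mx row0.
  by rewrite colE mulmxA -colE => /matrixP/(_ 0 0); rewrite [LHS]mxE [RHS]mxE.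
exists (fun t => a 0 (enum_rank t)); rewrite xE mulmx_sum_row.
rewrite (reindex enum_rank) /=; last exact: onW_bij (enum_rank_bij _).
by apply: eq_bigr => t _; rewrite rowK enum_rankK.
Qed.

Lemma lspan_sum (V : lmodType R) (S : set V) (I : finType) (a : I -> R) (y : I -> V) :
  (forall t, S (y t)) -> lspan S (\sum_t a t *: y t).
Proof.
move=> Sy; exists #|I|, (fun j => a (enum_val j)), (fun j => y (enum_val j)).
split=> [j|]; first exact: Sy.
rewrite (reindex (@enum_val I I)) //=; exact: onW_bij (enum_val_bij _).
Qed.

End FiniteSpan.

Section AffineStress.
Variables (R : realType) (n d : nat).
Implicit Types (D : {set {set 'I_n}}) (p : 'I_n -> 'rV[R]_d) (q w : mpoly n R).

Definition homogenize p (v : 'I_n) : 'rV[R]_d.+1 := row_mx (1%:M : 'M_1) (p v).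

Lemma homogenize_sum p (Q : pred 'I_n) (a : 'I_n -> R) :
  \sum_(v | Q v) a v *: homogenize p v =
  row_mx (\sum_(v | Q v) a v)%:M (\sum_(v | Q v) a v *: p v) :> 'rV_(1 + d).
Proof.
elim/big_rec3: _ => [|v x y z _ ->]; first by rewrite raddf0 row_mx0.
rewrite (_ : a v *: homogenize p v = row_mx (a v)%:M (a v *: p v)); last first.
  apply: (etrans (scale_row_mx (a v) 1%:M (p v))).
  by rewrite scale_scalar_mx mulr1.
by apply: (etrans (add_row_mx _ _ _ _)); rewrite -raddfD.
Qed.

Lemma homogenize_sum_eq0 p (Q : pred 'I_n) (a : 'I_n -> R) :
  \sum_(v | Q v) a v *: homogenize p v = 0 <->
  \sum_(v | Q v) a v = 0 /\ \sum_(v | Q v) a v *: p v = 0.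
Proof.
rewrite homogenize_sum; split=> [a0|[-> ->]]; last by rewrite raddf0; exact: (@row_mx0 _ 1 1 d).
have [+ ->] := @eq_row_mx R 1 1 d _ _ _ _ (etrans a0 (esym (@row_mx0 R 1 1 d))).
by move=> /matrixP/(_ 0 0); rewrite !mxE mulr1n.
Qed.

Lemma aff_indep_homogenize p F : aff_indep p F -> lin_indep (homogenize p) F.
Proof. by move=> Fp a /homogenize_sum_eq0[a0 ap0]; apply: Fp. Qed.

Lemma homog1_linform q : q \is @ishomog1 n R 1 mdeg ->
  q = linform (fun v => mcoeff (mnm1 v) q).
Proof.
move=> q1; have l1 : linform (fun v => mcoeff (mnm1 v) q) \is @ishomog1 n R 1 mdeg.
  by rewrite -[linform _]expr1; exact: dhomog_linform_exp.
apply/mpolyP => m; have [/mdeg1P[v /eqP ->]|m1] := boolP (mdeg m == 1%N).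
  by rewrite mcoeff_linform.
by rewrite (dhomog_nemf_coeff q1 m1) (dhomog_nemf_coeff l1 m1).
Qed.

Lemma msupp_mderivm (mu m : multinom n) w :
  m \in msupp (mderivm mu w) -> mnm_add mu m \in msupp w.
Proof.
rewrite !mcoeff_msupp mcoeff_mderivm; apply: contra => /eqP ->.
by rewrite mul0rn.
Qed.

Lemma dlin_sum D l (I : finType) (a : I -> R) (f : I -> mpoly n R) :
  dlin D l (\sum_t a t *: f t) = \sum_t a t *: dlin D l (f t).
Proof.
rewrite /dlin; under eq_bigr => v _ do rewrite (linear_sum (mderiv v)) scaler_sumr.
rewrite exchange_big /=; apply: eq_bigr => t _; rewrite scaler_sumr.
by apply: eq_bigr => v _; rewrite mderivZ !scalerA mulrC.
Qed.

Lemma dlin_mderivm D l mu w : dlin D l (mderivm mu w) = mderivm mu (dlin D l w).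
Proof.
rewrite /dlin (linear_sum (mderivm mu)) /=; apply: eq_bigr => v _.
rewrite mderivmZ -!mderivmU1m -!mderivmDm; congr (_ *: mderivm _ _).
by apply/mnmP => u; rewrite !mnmDE addnC.
Qed.

(** Derivations with constant coefficients commute, and every monomial of a derivative divides a
    monomial of [w], so its support is again a face. *)
Lemma stress_mderivm D p r mu w : is_complex D -> (mdeg mu <= r)%N ->
  stress r D p w -> stress (r - mdeg mu) D p (mderivm mu w).
Proof.
move=> [_ subD] mur [/dhomogP wr wD wp w1]; split.
- apply/dhomogP => m /msupp_mderivm/wr /=; rewrite mdegD => <-.
  by rewrite addKn.
- move=> m /msupp_mderivm/wD mD; apply: subD mD _.
  apply/fintype.subsetP => v; rewrite !inE mnmDE addn_eq0 negb_and orbC => -> //.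
- by move=> j; rewrite dlin_mderivm wp linear0.
- by rewrite dlin_mderivm w1 linear0.
Qed.

Lemma stress_sum D p r (I : finType) (a : I -> R) (f : I -> mpoly n R) :
  (forall t, stress r D p (f t)) -> stress r D p (\sum_t a t *: f t).
Proof.
move=> fr; split.
- by apply: rpred_sum => t _; apply: rpredZ; case: (fr t).
- move=> m /msupp_sum_le/flattenP[s /mapP[t _ ->]] /msuppZ_le.
  by case: (fr t) => _ + _ _; apply.
- by move=> j; rewrite dlin_sum big1 // => t _; case: (fr t) => _ _ -> _; rewrite scaler0.
- by rewrite dlin_sum big1 // => t _; case: (fr t) => _ _ _ ->; rewrite scaler0.
Qed.


(** Derivatives of a linear form are constants, so the stress equations become the coordinates of a
    linear dependence of the points [(1, p v)]. *)
Lemma stress1_linform D p (x : 'I_n -> R) : is_complex D ->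
  stress 1 D p (linform x) <->
  (forall v, v \notin vertices D -> x v = 0) /\ \sum_v x v *: homogenize p v = 0.
Proof.
move=> cD; have dlinE l : dlin D l (linform x) = (\sum_(v in vertices D) l v * x v) *: 1.
  rewrite /dlin scaler_suml; apply: eq_bigr => v _.
  by rewrite mderiv_linform scalerA.
have supp0 : (forall v, v \notin vertices D -> x v = 0) ->
    forall l, \sum_(v in vertices D) l v * x v = \sum_v l v * x v.
  move=> xD l; rewrite [RHS](bigID (mem (vertices D))) /= [X in _ = _ + X]big1 ?addr0 //.
  by move=> v /xD ->; rewrite mulr0.
have sE : \sum_v x v *: homogenize p v = 0 <->
    \sum_v 1 * x v = 0 /\ forall j, \sum_v p v 0 j * x v = 0.
  rewrite homogenize_sum_eq0; split=> -[x0 xp0]; split.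
  - by under eq_bigr do rewrite mul1r.
  - move=> j; move/rowP/(_ j): xp0; rewrite summxE mxE => {2}<-.
    by apply: eq_bigr => v _; rewrite mxE mulrC.
  - by move: x0; under eq_bigr do rewrite mul1r.
  - apply/rowP => j; rewrite summxE mxE -[RHS](xp0 j).
    by apply: eq_bigr => v _; rewrite mxE mulrC.
have C0 (k : R) : k *: (1 : mpoly n R) = 0 -> k = 0.
  by move/eqP; rewrite scaler_eq0 oner_eq0 orbF => /eqP.
split=> [[_ xD xp x1]|[xD /sE[x1 xp]]].
  have xV v : v \notin vertices D -> x v = 0.
    rewrite inE => vD; apply: contraTeq vD => xv; rewrite negbK.
    have := xD (mnm1 v); rewrite mcoeff_msupp mcoeff_linform xv => /(_ isT).
    by congr (_ \in D); apply/setP => u; rewrite !inE mnm1E eqb0 negbK eq_sym.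
  split=> //; apply/sE; split=> [|j].
    by rewrite -supp0 //; apply: C0; rewrite -dlinE.
  by rewrite -supp0 //; apply: C0; rewrite -dlinE.
split.
- by rewrite -[linform _]expr1; exact: dhomog_linform_exp.
- move=> m; rewrite -[linform x]expr1 => mx.
  have /mdeg1P[v /eqP mv] : mdeg m == 1%N by apply/eqP; exact: (dhomog_mf (dhomog_linform_exp x 1) mx).
  have := @supported_linform_exp _ _ (vertices D) x 1 xD m mx v; rewrite mv mnm1E eqxx => /(_ isT).
  by rewrite inE; congr (_ \in D); apply/setP => u; rewrite !inE mnm1E eqb0 negbK eq_sym.
- by move=> j; rewrite dlinE supp0 // xp scale0r.
- by rewrite dlinE supp0 // x1 scale0r.
Qed.

Lemma mdeg_seq_mon (l : seq 'I_n) : mdeg (seq_mon l) = size l.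
Proof. by elim: l => [|v l IH] /=; rewrite ?mdeg0 // mdegD mdeg1 IH. Qed.

Lemma seq_monE (l : seq 'I_n) v : seq_mon l v = count_mem v l.
Proof. by elim: l => [|u l IH] /=; rewrite ?mnm0E // mnmDE mnm1E IH. Qed.

Lemma lspan_stress_sub D p i mus : is_complex D -> (0 < i)%N ->
    (forall mu, mus mu -> mdeg mu = i.-1) ->
  lspan [set mderivm mu w | mu in mus & w in stress i D p] `<=` stress 1 D p.
Proof.
move=> cD i0 musP _ [m [a [y [yS ->]]]]; apply: stress_sum => t.
have [mu /musP muD [w ws <-]] := yS t.
have mui : (mdeg mu <= i)%N by rewrite muD leq_pred.
have := stress_mderivm cD mui ws.
by rewrite muD (_ : i - i.-1 = 1)%N //; move: i0; clear; lia.
Qed.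

End AffineStress.

(** * Stacked balls *)

Section StackedSpan.
Variables (R : realType) (n d i k : nat) (B : {set {set 'I_n}}) (p : 'I_n -> 'rV[R]_d).
Implicit Types (F G : {set 'I_n}).
Hypotheses (hi : (1 <= i)%N) (hik : (i <= k)%N) (hkd : (2 * k + 2 <= d)%N).
Hypotheses (ballB : homology_ball R d B) (stackB : stacked_ball R d k B).
Local Notation D := (boundary_complex R B).
Hypothesis missD : forall F, missing_face D F -> fdim F < d%:Z - i%:Z + 1.
Hypothesis indepT : forall F, F \in Tcomplex d k D -> fdim F = d%:Z -> aff_indep p F.
Local Notation P := (homogenize p).
Local Notation derivs :=
  [set mderivm mu w | mu in sqfree_mon i.-1 (vertices D) & w in stress i D p].

Let subB F G : F \in B -> G \subset F -> G \in B.
Proof. by case: ballB => [[_ +] _ _ _ _]; apply. Qed.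

Let leq_pred_id : (i.-1 <= d)%N.
Proof. by move: hik hkd; clear; lia. Qed.

Let leq_i_dk : (i <= d - k)%N.
Proof. by move: hik hkd; clear; lia. Qed.

Let set0B : finset.set0 \in B. Proof. by case: ballB => [[]]. Qed.

Let complexD : is_complex D.
Proof. by case: ballB => _ _ _ _ []. Qed.

Let small_in_boundary F : F \in B -> (#|F| <= d - k)%N -> F \in D.
Proof. by move=> FB Fdk; apply: stackB FB _; rewrite /fdim; lia. Qed.

Let vertexD v : [set v]%SET \in B -> [set v]%SET \in D.
Proof. by move=> vB; apply: small_in_boundary vB _; rewrite cards1; lia. Qed.

Let face_vertices F : F \in B -> F \subset vertices D.
Proof.
move=> FB; apply/fintype.subsetP => v vF; rewrite inE; apply: vertexD.
by apply: subB FB _; rewrite finset.sub1set.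
Qed.

(** By stackedness all subsets of a facet with at most [d - k] elements are boundary faces, so
    facets of the ball belong to [Tcomplex d k D]. *)
Lemma stacked_facet_indep F : F \in B -> #|F| = d.+1 -> lin_indep P F.
Proof.
move=> FB Fd; apply: aff_indep_homogenize; apply: indepT; last first.
  by rewrite /fdim Fd; lia.
rewrite inE face_vertices //=; apply/forallP => G; apply/implyP => /andP[GF Gdk].
by apply: small_in_boundary Gdk; apply: subB FB GF.
Qed.

Lemma stacked_ridge_stress G a b : #|G| = d -> a != b -> a \notin G -> b \notin G ->
    (a |: G \in B)%SET -> (b |: G \in B)%SET ->
  exists x : 'rV[R]_n, [/\ derivs (linform (x 0)), x 0 b != 0,
    forall v, v \notin (a |: (b |: G))%SET -> x 0 v = 0 & \sum_v x 0 v *: P v = 0].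
Proof.
move=> Gd ab aG bG aB bB.
have GD := ridge_interior ballB Gd ab aG bG aB bB.
have GB : G \in B := subB aB (finset.subsetUr _ _).
(* Dimension below [d - i + 1] means at most [d - i + 1] vertices, which is [d - i.-1]. *)
have missD' F : missing_face D F -> (#|F| <= d - i.-1)%N by move=> /missD; rewrite /fdim; lia.
have Gi : (d - i.-1 <= #|G|)%N by rewrite Gd leq_subr.
have [A [AB AD AG Am]] := interior_subface ballB vertexD missD' GB GD Gi.
have cardA : (#|A| + i.-1)%N = d by rewrite Am subnK.
have [w [wh wB wth [x [wx xb xG]]]] :=
  ridge_stress ballB stacked_facet_indep AB AD cardA AG Gd ab aG bG aB bB.
have i1 : i.-1.+1 = i by rewrite prednK.
(* A monomial of degree [i] involves at most [i <= d - k] vertices; its support is a face of [B]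
   small enough to lie in the boundary. *)
have wD m : m \in msupp w -> [set v | m v != 0%N]%SET \in D.
  move=> mw; have [F FB mF] := wB m mw; apply: small_in_boundary.
    by apply: subB FB _; apply/fintype.subsetP => v; rewrite inE; exact: mF.
  have : (#|[set v | m v != 0%N]%SET| <= mdeg m)%N.
    rewrite mdegE -sum1_card big_mkcond /=; apply: leq_sum => v _.
    by rewrite inE; case: (m v).
  by move=> /leq_trans; apply; rewrite (dhomog_mf wh mw) i1.
have wdlin l (th : 'cV[R]_d.+1) : (forall v, l v = (P v *m th) 0 0) -> dlin D l w = 0.
  move=> lth; rewrite -[RHS](wth th) /dlin.
  rewrite [RHS](bigID (mem (vertices D))) /= [X in _ = _ + X]big1 ?addr0.
    by apply: eq_bigr => v _; rewrite lth.
  move=> v vD; suff -> : mderiv v w = 0 by rewrite scaler0.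
  apply/mpolyP => m; rewrite mcoeff_mderiv mcoeff0.
  suff -> : mcoeff (mnm_add m (mnm1 v)) w = 0 by rewrite mul0rn.
  apply: contraNeq vD; rewrite -mcoeff_msupp => /wD wm.
  rewrite inE; apply: (complexD.2 _ _ wm); rewrite finset.sub1set inE mnmDE mnm1E eqxx.
  by rewrite addn1.
have ws : stress i D p w.
  split=> // [|j|]; first by rewrite i1 in wh.
    (* Coordinate functionals of the homogenized points: the last [d] ones give the forms theta, the
       first one gives the sum of the variables. *)
    apply: (wdlin _ (delta_mx (rshift 1 j) 0)) => v.
    by rewrite -colE mxE (row_mxEr (1%:M : 'M_1)).
  apply: (wdlin _ (delta_mx (@lshift 1 d ord0) 0)) => v.
  by rewrite -colE mxE (row_mxEl (1%:M : 'M_1)) mxE.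
have Dw : derivs (linform x).
  exists (seq_mon (enum (G :\: A)%SET)); last by exists w.
  split; first by rewrite mdeg_seq_mon -cardE finset.cardsDS // Gd Am subKn.
  move=> v; rewrite seq_monE count_uniq_mem ?enum_uniq // mem_enum inE.
  case: (boolP (v \in G)) => vG; rewrite ?andbF //.
  by rewrite (fintype.subsetP (face_vertices GB) v vG) leq_b1.
have xE : linform ((\row_v x v) 0) = linform x.
  by rewrite /linform; apply: eq_bigr => v _; rewrite mxE.
exists (\row_v x v); split.
- by rewrite xE.
- by rewrite mxE.
- by move=> v /xG; rewrite mxE.
- have xs : stress 1 D p (linform x).
    apply: (@lspan_stress_sub _ _ _ D p i (sqfree_mon i.-1 (vertices D))) => //.
      by move=> mu [].
    exists 1%N, (fun=> 1), (fun=> linform x); split=> //.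
    by rewrite big_ord1 scale1r.
  have [_ xP] := (stress1_linform p x complexD).1 xs.
  by rewrite -[RHS]xP; apply: eq_bigr => v _; rewrite mxE.
Qed.

Let ridge_pair (t : {set 'I_n} * 'I_n * 'I_n) :=
  let: (G, a, b) := t in
  [&& #|G| == d, a != b, a \notin G, b \notin G, (a |: G)%SET \in B & (b |: G)%SET \in B].

Lemma stress1_span_derivs q : stress 1 D p q -> lspan derivs q.
Proof.
move=> qs; have qh : q \is @ishomog1 n R 1 mdeg by case: qs.
pose x := \row_v mcoeff (mnm1 v) q.
have qx : q = linform (x 0).
  by rewrite {1}(homog1_linform qh) /linform; apply: eq_bigr => v _; rewrite mxE.
have [xV xP] : (forall v, v \notin vertices D -> x 0 v = 0) /\ \sum_v x 0 v *: P v = 0.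
  by apply/stress1_linform => //; rewrite -qx.
pose I : finType := {t : {set 'I_n} * 'I_n * 'I_n | ridge_pair t}.
have /boolp.choice[f fP] : forall t : I, exists y : 'rV[R]_n,
    let: (G, a, b) := val t in [/\ derivs (linform (y 0)), y 0 b != 0,
    forall v, v \notin (a |: (b |: G))%SET -> y 0 v = 0 & \sum_v y 0 v *: P v = 0].
  move=> [[[G a] b] /= /andP[/eqP Gd /and5P[ab aG bG aB bB]]].
  exact: stacked_ridge_stress.
have [a xE] : exists a : I -> R, x = \sum_t a t *: f t.
  (* By duality, it suffices that heights [h] annihilating all ridge dependences annihilate [x]. *)
  apply: span_of_annihilator => h fh.
  have [F0 [F0B _ F0d]] := ball_pure ballB set0B.
  have [E [E_dual _]] := dual_basis (stacked_facet_indep F0B F0d) F0d.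
  (* The linear functional that interpolates [h] on one facet; it will turn out to interpolate [h]
     on every facet. *)
  pose al := \sum_(v in F0) h v 0 *: E v.
  have al0 u : u \in F0 -> (P u *m al) 0 0 = h u 0.
    move=> uF; rewrite mulmx_sumr summxE (bigD1 u) //= big1 ?addr0 => [|v /andP[vF vu]].
      by rewrite -scalemxAr mxE E_dual // eqxx mulr1.
    by rewrite -scalemxAr mxE E_dual // eq_sym (negPf vu) mulr0.
  have alF F : F \in B -> #|F| = d.+1 -> forall u, u \in F -> (P u *m al) 0 0 = h u 0.
    move=> FB Fd; pose Q (F : {set 'I_n}) := forall u, u \in F -> (P u *m al) 0 0 = h u 0.
    apply: (@ball_strongly_connected _ _ _ _ ballB finset.set0 Q set0B _ F0 F) => //;
      rewrite ?finset.sub0set //.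
    move=> G a b _ Gd ab aG bG aB bB QG u.
    rewrite in_setU1 => /orP[/eqP ->|uG]; last by apply: QG; rewrite setU1r.
    have tP : ridge_pair (G, a, b) by rewrite /= Gd eqxx ab aG bG aB bB.
    have [_ yb yG yP] := fP (exist _ (G, a, b) tP : I).
    move: (fh (exist _ (G, a, b) tP : I)) yb yG yP; move: (f _) => y yh yb yG yP.
    (* Both [h] and [al] annihilate the dependence [y]. Their difference vanishes on [a |: G] and
       [y] vanishes off the two facets, so only the term of [b] survives. *)
    have : \sum_v y 0 v * (h v 0 - (P v *m al) 0 0) = 0.
      under eq_bigr do rewrite mulrBr.
      rewrite sumrB (_ : \sum_v y 0 v * h v 0 = 0) ?sub0r; last first.
        by move/matrixP/(_ 0 0): yh; rewrite !mxE.
      move/(congr1 (fun z => (z *m al) 0 0)): yP; rewrite mul0mx mulmx_suml summxE mxE.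
      move=> y0; rewrite -[RHS]oppr0 -[in RHS]y0; congr (- _); apply: eq_bigr => v _.
      by rewrite -scalemxAl [RHS]mxE.
    rewrite (bigD1 b) //= big1 ?addr0 => [/eqP|v vb].
      by rewrite mulf_eq0 (negPf yb) subr_eq0 => /eqP.
    have [vG|vG] := boolP (v \in (a |: G)%SET); first by rewrite QG // subrr mulr0.
    rewrite yG ?mul0r //; move: vG; rewrite !inE !negb_or vb => /andP[-> ->] //.
  apply/matrixP => i0 j0; rewrite !ord1 mxE [RHS]mxE.
  move/(congr1 (fun z => (z *m al) 0 0)): xP; rewrite mul0mx mulmx_suml summxE [RHS]mxE.
  move=> x0; rewrite -[RHS]x0; apply: eq_bigr => v _; rewrite -scalemxAl [RHS]mxE.
  have [vD|/xV ->] := boolP (v \in vertices D); last by rewrite !mul0r.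
  rewrite inE in vD; have [F [FB vF Fd]] := ball_pure ballB (boundary_sub vD).
  by rewrite (alF F FB Fd) // -finset.sub1set.
have -> : q = \sum_t a t *: linform (f t 0).
  rewrite linform_sum qx /linform; apply: eq_bigr => v _; congr (_ *: _).
  by rewrite xE summxE; apply: eq_bigr => t _; rewrite mxE.
apply: lspan_sum => t; have := fP t.
by case: (val t) => [[G u] v] [].
Qed.

End StackedSpan.

(** * Polytopes *)

Section PolytopeGeometry.
Variables (R : realType) (n d : nat).
Implicit Types (p q : 'I_n -> 'rV[R]_d) (F G : {set 'I_n}).

Lemma dotp_sum (al : 'rV[R]_d) (I : finType) (Q : pred I) (a : I -> R) (y : I -> 'rV[R]_d) :
  dotp al (\sum_(t | Q t) a t *: y t) = \sum_(t | Q t) a t * dotp al (y t).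
Proof.
rewrite /dotp; under eq_bigr => j _ do rewrite summxE mulr_sumr.
rewrite exchange_big; apply: eq_bigr => t _; rewrite mulr_sumr.
by apply: eq_bigr => j _; rewrite mxE mulrCA.
Qed.

Lemma hull_point p v : hull p (p v).
Proof.
exists (fun u => (u == v)%:R); split=> [u||].
- exact: ler0n.
- by rewrite (bigD1 v) //= eqxx big1 ?addr0 // => u /negPf ->.
- by rewrite (bigD1 v) //= eqxx scale1r big1 ?addr0 // => u /negPf ->; rewrite scale0r.
Qed.

(* The supporting functional of the face spanned by the positive part vanishes on that
   part, so that it forces the negative part of the dependence to be empty. *)
Lemma positive_face_dependence p F (a : 'I_n -> R) :
    [set v in F | 0 < a v]%SET \in polytope_complex p ->
    \sum_(v in F) a v = 0 -> \sum_(v in F) a v *: p v = 0 ->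
  forall v, v \in F -> a v = 0.
Proof.
rewrite inE => /asboolP[_ [[al [b [hb ->]] _ memG]]] a0 ap0.
have s0 v : 0 <= b - dotp al (p v) by rewrite subr_ge0; apply: hb; exact: hull_point.
have t0 v : v \in F -> 0 <= - (a v * (b - dotp al (p v))).
  move=> vF; rewrite -mulNr; have [av|av] := ltP 0 (a v).
    have /memG[_ /= ->] : v \in [set v in F | 0 < a v]%SET by rewrite inE vF.
    by rewrite subrr mulr0.
  by rewrite mulr_ge0 // oppr_ge0.
have ts : \sum_(v in F) - (a v * (b - dotp al (p v))) = 0.
  rewrite sumrN; under eq_bigr do rewrite mulrBr.
  rewrite sumrB -mulr_suml a0 mul0r -dotp_sum ap0 /dotp big1 ?subrr ?oppr0 // => j _.
  by rewrite mxE mulr0.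
have aneg v : v \in F -> 0 <= a v.
  move=> vF; have /eqP : - (a v * (b - dotp al (p v))) = 0 by apply: (psumr_eq0P t0 ts).
  rewrite oppr_eq0 mulf_eq0 => /orP[/eqP -> //|]; rewrite subr_eq0 => /eqP bE.
  have /memG : (hull p `&` [set x | dotp al x = b]) (p v).
    by split; [exact: hull_point|rewrite /= bE].
  by rewrite inE => /andP[_ /ltW].
exact: psumr_eq0P.
Qed.

Lemma Tcomplex_facet_indep (k : nat) p F : (2 * k + 2 <= d)%N ->
  F \in Tcomplex d k (polytope_complex p) -> fdim F = d%:Z -> aff_indep p F.
Proof.
move=> hkd; rewrite inE => /andP[_ /forallP FT] Fd a a0 ap0.
have face Q : (#|[set v in F | Q v]%SET| <= d - k)%N ->
    [set v in F | Q v]%SET \in polytope_complex p.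
  move=> Qdk; move: (FT [set v in F | Q v]%SET) => /implyP; apply.
  by rewrite Qdk andbT; apply/fintype.subsetP => v; rewrite inE => /andP[].
have small : (#|[set v in F | (0 < a v)%R]%SET| + #|[set v in F | (0 < - a v)%R]%SET| <= #|F|)%N.
  rewrite -cardsUI (_ : _ :&: _ = finset.set0)%SET ?cards0 ?addn0.
    by apply: subset_leq_card; apply/fintype.subsetP => v; rewrite !inE => /orP[] /andP[].
  apply/setP => v; rewrite !inE; apply/negbTE/negP => /andP[/andP[_ av] /andP[_]].
  by rewrite oppr_gt0 ltNge (ltW av).
have [pos|neg] := leqP #|[set v in F | 0 < a v]%SET| (d - k).
  exact: positive_face_dependence (face _ pos) a0 ap0.
(* Among [d + 1] points, more than [d - k] positive ones leave at most [k <= d - k] negative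
   ones. *)
have negdk : (#|[set v in F | (0 < - a v)%R]%SET| <= d - k)%N.
  by move: small neg hkd Fd; rewrite /fdim; clear; lia.
move=> v vF; apply/eqP; rewrite -oppr_eq0; apply/eqP.
apply: (@positive_face_dependence p F (fun v => - a v)) => //.
- exact: face.
- by rewrite sumrN a0 oppr0.
- by under eq_bigr do rewrite scaleNr; rewrite sumrN ap0 oppr0.
Qed.

Lemma polytope_vertex p v : (0 < d)%N -> simplicial_polytope p ->
  [set v]%SET \in polytope_complex p.
Proof.
move=> d0 [injp vertp [F Fd _] _]; rewrite inE; apply/asboolP.
exists ([set p v]%classic); split=> //; last first.
  by move=> u; rewrite inE; split=> [/eqP ->//|/injp ->].
move=> hullE; have /card_gt1P[x [y [_ _ xy]]] : (1 < #|F|)%N by rewrite Fd.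
have hx u : p u = p v by have : [set p v]%classic (p u) by rewrite hullE; exact: hull_point.
by move/eqP: xy; apply; apply: injp; rewrite !hx.
Qed.

(** The linear map sending the homogenized basis [p] on [F] to [q] sends every [p u] to [q u],
    because the expansion of [p u] in this basis is a dependence, shared by [q]. Preserving the
    first coordinate 1 makes it affine. *)
Lemma affinely_equivalent_dependences p q F F' :
    #|F| = d.+1 -> aff_indep p F -> #|F'| = d.+1 -> aff_indep q F' ->
    (forall x : 'I_n -> R, \sum_v x v *: homogenize p v = 0 ->
       \sum_v x v *: homogenize q v = 0) ->
  affinely_equivalent p q.
Proof.
move=> Fd Fp F'd F'q dep.
have [e [e_dual e_sum]] := dual_basis (aff_indep_homogenize Fp) Fd.
have [e' [_ e'_sum]] := dual_basis (aff_indep_homogenize F'q) F'd.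
pose M : 'M[R]_(1 + d) := \sum_(v in F) e v *m homogenize q v.
pose M' : 'M[R]_(1 + d) := \sum_(v in F') e' v *m homogenize p v.
have sumM (f : 'I_n -> 'cV[R]_d.+1) (g : 'I_n -> 'rV[R]_d.+1) (H : {set 'I_n})
    (y : 'rV[R]_d.+1) :
    y *m (\sum_(v in H) f v *m g v) = \sum_(v in H) (y *m f v) 0 0 *: g v.
  rewrite mulmx_sumr; apply: eq_bigr => v _; rewrite mulmxA.
  by rewrite {1}[y *m f v]mx11_scalar mul_scalar_mx.
have pM u : homogenize p u *m M = homogenize q u.
  pose x v := (v == u)%:R - (if v \in F then (homogenize p u *m e v) 0 0 else 0).
  have xE (r : 'I_n -> 'rV[R]_d.+1) : \sum_v x v *: r v =
      r u - \sum_(v in F) (homogenize p u *m e v) 0 0 *: r v.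
    under eq_bigr do rewrite scalerBl.
    rewrite sumrB; congr (_ - _).
      by rewrite (bigD1 u) //= eqxx scale1r big1 ?addr0 // => v /negPf ->; rewrite scale0r.
    by rewrite [RHS]big_mkcond /=; apply: eq_bigr => v _; case: ifP; rewrite ?scale0r.
  have /eqP : \sum_v x v *: homogenize q v = 0.
    by apply: dep; rewrite xE -e_sum subrr.
  by rewrite xE subr_eq0 => /eqP ->; rewrite -sumM.
(* [M'] sends the basis [q] on [F'] back to [p], so [M' *m M] fixes that basis pointwise. *)
have Munit : M \in unitmx.
  suff : M' *m M = 1%:M by move=> /mulmx1_unit[].
  apply/row_matrixP => j; rewrite row_mul rowE /M' [X in X *m M]sumM mulmx_suml.
  rewrite row1 [RHS](e'_sum (delta_mx 0 j)); apply: eq_bigr => v _.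
  by rewrite -scalemxAl pM.
have col0 (c : 'cV[R]_d.+1) : (forall u, homogenize p u *m c = 0) -> c = 0.
  move=> pc; apply/row_matrixP => j; rewrite row0 rowE (e_sum (delta_mx 0 j)).
  by rewrite mulmx_suml big1 // => v _; rewrite -scalemxAl pc scaler0.
have blockM u : row_mx 1%:M (q u) = row_mx (ulsubmx M + p u *m dlsubmx M)
    (ursubmx M + p u *m drsubmx M).
  have := pM u; rewrite /homogenize -{1}(submxK M).
  by move=> <-; rewrite (@mul_row_block R 1 1 d 1 d) !mul1mx.
have qE u : q u = p u *m drsubmx M + ursubmx M.
  by have [_ ->] := eq_row_mx (blockM u); rewrite addrC.
(* The homogenized points of [p] span, so comparing first coordinates determines the first block
   column of [M]: it is 1 above 0. *)
have pc u : homogenize p u *m (col_mx (ulsubmx M - 1%:M) (dlsubmx M) : 'cV[R]_d.+1) = 0.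
  apply: etrans (@mul_row_col R 1 1 d 1 _ _ _ _) _; rewrite mul1mx.
  by have [E _] := eq_row_mx (blockM u); rewrite addrAC -E subrr.
have : (ulsubmx M - 1%:M == 0) && (dlsubmx M == 0).
  by rewrite -(@col_mx_eq0 R 1 d 1); apply/eqP; exact: col0 pc.
rewrite subr_eq0 => /andP[/eqP ul1 /eqP dl0].
exists (drsubmx M), (ursubmx M); split=> //.
  move: Munit; rewrite !unitmxE -{1}(submxK M) ul1 dl0 (@det_ublock R 1 d) det1 mul1r.
  by [].
have hullE (a : 'I_n -> R) : \sum_v a v = 1 ->
    \sum_v a v *: q v = (\sum_v a v *: p v) *m drsubmx M + ursubmx M.
  move=> a1; rewrite mulmx_suml -[ursubmx M in RHS]scale1r -a1 scaler_suml -big_split.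
  by apply: eq_bigr => v _; rewrite qE scalerDr scalemxAl.
apply/seteqP; split=> [_ [_ [a [a0 a1 ->]] <-]|_ [a [a0 a1 ->]]].
  by exists a; rewrite hullE.
by exists (\sum_v a v *: p v); [exists a|rewrite hullE].
Qed.

End PolytopeGeometry.

(** * Spanning by derivatives, and reconstruction from the stresses *)

Theorem theorem7p1 (R : realType) (d i k : nat)
    (hi : (1 <= i)%N) (hik : (i <= k)%N) (hkd : (2 * k + 2 <= d)%N) :
  [/\ (forall (n : nat) (D : {set {set 'I_n}}) (p : 'I_n -> 'rV[R]_d),
         stacked_embedding i k D p ->
         stress 1 D p =
         lspan [set mderivm mu w
               | mu in sqfree_mon i.-1 (vertices D) & w in stress i D p]),
      (forall (n : nat) (D D' : {set {set 'I_n}}) (p p' : 'I_n -> 'rV[R]_d),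
         stacked_embedding i k D p -> stacked_embedding i k D' p' ->
         stress i D p = stress i D' p' -> stress 1 D p = stress 1 D' p')
    & (forall (n : nat) (p q : 'I_n -> 'rV[R]_d),
         simplicial_polytope p ->
         k_stacked R d k (polytope_complex p) ->
         (forall F, missing_face (polytope_complex p) F ->
            fdim F < d%:Z - i%:Z + 1) ->
         simplicial_polytope q ->
         stress i (polytope_complex p) p = stress i (polytope_complex q) q ->
         affinely_equivalent p q)].
Proof.
have span n (D : {set {set 'I_n}}) (p : 'I_n -> 'rV[R]_d) : k_stacked R d k D ->
    (forall F, missing_face D F -> fdim F < d%:Z - i%:Z + 1) ->
    (forall F, F \in Tcomplex d k D -> fdim F = d%:Z -> aff_indep p F) ->
    stress 1 D p `<=` lspan [set mderivm mu w
      | mu in sqfree_mon i.-1 (vertices D) & w in stress i D p].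
  move=> [B [ballB stackB <-]] missD indepT q.
  exact: (stress1_span_derivs hi hik hkd ballB stackB missD indepT).
have complexD n (D : {set {set 'I_n}}) : k_stacked R d k D -> is_complex D.
  by move=> [B [[_ _ _ _ []] + _ _ _ <-]].
split.
- move=> n D p [_ kD missD indepT]; apply/seteqP; split; first exact: span.
  apply: lspan_stress_sub => //; first exact: complexD kD.
  by move=> mu [].
- have sub n (D D' : {set {set 'I_n}}) (p p' : 'I_n -> 'rV[R]_d) :
      stacked_embedding i k D p -> stacked_embedding i k D' p' ->
      stress i D p = stress i D' p' -> stress 1 D p `<=` stress 1 D' p'.
    move=> [_ kD missD indepT] [_ kD' _ _] eqs.
    apply: subset_trans (span _ _ _ kD missD indepT) _; rewrite eqs.
    apply: lspan_stress_sub => //; first exact: complexD kD'.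
    by move=> mu [].
  move=> n D D' p p' eD eD' eqs; apply/seteqP.
  by split; apply: sub.
- move=> n p q sp kp missp sq eqs.
  have d0 : (0 < d)%N by apply: leq_trans hkd; rewrite addn2.
  have [_ _ [F Fd Fp] _] := sp; have [_ _ [F' F'd F'q] _] := sq.
  apply: (affinely_equivalent_dependences Fd Fp F'd F'q) => x xp.
  have x1 : stress 1 (polytope_complex p) p (linform x).
    apply/(stress1_linform _ _ (complexD _ _ kp)); split=> // v.
    by rewrite inE polytope_vertex.
  have := span _ _ _ kp missp (fun F => @Tcomplex_facet_indep _ _ _ _ p F hkd) _ x1.
  rewrite eqs => xspan.
  (* After rewriting with [eqs], [linform x] is a combination of derivatives of [i]-stresses of [q].
     A constant-coefficient derivation killing these stresses commutes with the derivatives and so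
     kills [linform x]. *)
  have xq l : (forall w, stress i (polytope_complex q) q w ->
      dlin (polytope_complex q) l w = 0) -> \sum_v x v * l v = 0.
    move=> lw; have : dlin (polytope_complex q) l (linform x) = 0.
      have [m [a [y [yS ->]]]] := xspan.
      rewrite dlin_sum big1 // => t _; have [mu _ [w ws <-]] := yS t.
      by rewrite dlin_mderivm lw // linear0 scaler0.
    rewrite /dlin (eq_bigl xpredT) => [|v]; last by rewrite inE polytope_vertex.
    under eq_bigr => v _ do rewrite mderiv_linform scalerA.
    rewrite -scaler_suml => /eqP; rewrite scaler_eq0 oner_eq0 orbF => /eqP lx.
    by rewrite -[RHS]lx; apply: eq_bigr => v _; rewrite mulrC.
  apply/homogenize_sum_eq0; split.
    rewrite -[RHS](xq (fun=> 1)) => [|w []//].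
    by apply: eq_bigr => v _; rewrite mulr1.
  apply/rowP => j; rewrite summxE [RHS]mxE -[RHS](xq (fun v => q v 0 j)) => [|w []//].
  by apply: eq_bigr => v _; rewrite mxE.
Qed.
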